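(* Let $\psi^*$ be a nondecreasing function on $[-\pi,\pi]$, let $\psi$ be the Stieltjes (Borel) measure on $\partial\mathbb{D}$ generated by $\psi^*$, let $0\le\gamma<1$ and $\zeta_0\in\partial\mathbb{D}$. For a Borel measure $\chi$ on $\partial\mathbb{D}$ put $h_\chi(z)=\int_{\partial\mathbb{D}}\frac{\zeta+z}{\zeta-z}\,d\chi(\zeta)$, $z\in\mathbb{D}$ (so $h_\psi(z)=\int_{-\pi}^{\pi}\frac{e^{it}+z}{e^{it}-z}\,d\psi^*(t)$). The following conditions are equivalent: 1) for every Borel measure $\chi$ on $\partial\mathbb{D}$ with $\chi\prec\psi$ and every $\sigma>1$ there exists a constant $K=K(\gamma,\sigma,\psi)>0$ such that $\sup_{z\in S^*_\sigma(\zeta_0)}|D^{-\gamma}h_\chi(z)|<K$; 2) for every Borel measure $\chi$ on $\partial\mathbb{D}$ with $\chi\prec\psi$ and every $\sigma>1$ there exists a constant $K=K(\gamma,\sigma,\psi)>0$ such that $\sup_{z\in S^*_\sigma(\zeta_0)}|D^{-\gamma}\operatorname{Im}h_\chi(z)|<K$; 3) $$\int_{\partial\mathbb{D}}\frac{d\psi(\zeta)}{|\zeta_0-\zeta|^{1-\gamma}}<\infty.$$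
   Context: $\mathbb{D}=\{|z|<1\}$. For Borel measures $\chi,\psi$ on $\partial\mathbb{D}$, $\chi\prec\psi$ means $\chi(M)\le\psi(M)$ for every Borel set $M\subset\partial\mathbb{D}$. Fractional integral: for $\gamma>0$, $D^{-\gamma}u(z)=\frac1{\Gamma(\gamma)}\int_0^{|z|}(|z|-x)^{\gamma-1}u(xz/|z|)\,dx$ (in the radial variable), $D^0u=u$. Stolz angle: $S_\sigma(\zeta)=\{z\in\mathbb{D}:|1-z\bar\zeta|\le\sigma(1-|z|)\}$, $S^*_\sigma(\zeta)=S_\sigma(\zeta)\cap\{|z-\zeta|<\tfrac12\}$. *)

(* Defs.v *)
From HB Require Import structures.
From mathcomp Require Import all_boot all_order all_algebra.
From mathcomp Require Import all_classical all_reals all_analysis.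
From mathcomp Require Import complex.
Set Implicit Arguments. Unset Strict Implicit. Unset Printing Implicit Defensive.
Import Order.TTheory GRing.Theory Num.Theory.
Import numFieldNormedType.Exports.
Local Open Scope classical_set_scope.
Local Open Scope ring_scope.

Section Defs.
Context {R : realType}.

Definition cabs (w : R[i]) : R := Num.sqrt (complex.Re w ^+ 2 + complex.Im w ^+ 2).

Definition toC (p : R * R) : R[i] := (p.1 +i* p.2)%C.

Definition unit_circle : set (R * R) := [set p | p.1 ^+ 2 + p.2 ^+ 2 = 1].

Definition disc : set R[i] := [set z | cabs z < 1].

(* A Borel measure on \partial D, represented as a Borel measure on R^2
   (product sigma-algebra = Borel sigma-algebra of R^2) carried by the circle. *)
Definition circle_measure (chi : {measure set (R * R) -> \bar R}) : Prop :=
  chi (~` unit_circle) = 0%E.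

Definition mprec (chi psi : {measure set (R * R) -> \bar R}) : Prop :=
  forall M : set (R * R), measurable M -> M `<=` unit_circle -> (chi M <= psi M)%E.

Definition nondecreasing_on_mpipi (psis : R -> R) : Prop :=
  forall x y : R, - pi <= x -> x <= y -> y <= pi -> psis x <= psis y.

Definition rlim (f : R -> R) (x : R) : R := lim (f y @[y --> x^'+]).

(* mu is the Lebesgue--Stieltjes measure of the nondecreasing function psi*
   on [-pi, pi]: it is carried by [-pi, pi], has total mass
   psi*(pi) - psi*(-pi), and mu([-pi, x]) = psi*(x+) - psi*(-pi) for
   -pi <= x < pi.  These values determine mu uniquely. *)
Definition stieltjes_of (psis : R -> R) (mu : {measure set R -> \bar R}) : Prop :=
  [/\ mu `]-oo, - pi[%classic = 0%E, mu `]pi, +oo[%classic = 0%E,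
      mu `[- pi, pi]%classic = (psis pi - psis (- pi))%:E &
      forall x : R, - pi <= x -> x < pi ->
        mu `[- pi, x]%classic = (rlim psis x - psis (- pi))%:E].

Definition generated_by (psis : R -> R) (psi : {measure set (R * R) -> \bar R}) : Prop :=
  exists mu : {measure set R -> \bar R},
    stieltjes_of psis mu /\
    forall M : set (R * R), measurable M ->
      psi M = mu ((fun t : R => (cos t, sin t)) @^-1` M).

Definition herglotz (chi : {measure set (R * R) -> \bar R}) (z : R[i]) : R[i] :=
  ((Rintegral chi unit_circle (fun p => complex.Re ((toC p + z) / (toC p - z))))
   +i* (Rintegral chi unit_circle (fun p => complex.Im ((toC p + z) / (toC p - z)))))%C.

Definition Gamma (g : R) : R :=
  Rintegral lebesgue_measure `]0, +oo[%classic (fun t => t `^ (g - 1) * expR (- t)).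

(* Riemann--Liouville fractional integral in the radial variable,
   for a real-valued u; D^0 u = u. *)
Definition fracintR (g : R) (u : R[i] -> R) (z : R[i]) : R :=
  if g == 0 then u z else
  (Gamma g)^-1 *
    Rintegral lebesgue_measure `[0, cabs z]%classic
      (fun x => (cabs z - x) `^ (g - 1) * u (((x / cabs z)%:C)%C * z)).

Definition fracintC (g : R) (u : R[i] -> R[i]) (z : R[i]) : R[i] :=
  ((fracintR g (fun w => complex.Re (u w)) z) +i* (fracintR g (fun w => complex.Im (u w)) z))%C.

Definition stolz (sigma : R) (zeta : R[i]) : set R[i] :=
  [set z | cabs z < 1 /\ cabs (1 - z * conjc zeta) <= sigma * (1 - cabs z)].

Definition stolz_star (sigma : R) (zeta : R[i]) : set R[i] :=
  stolz sigma zeta `&` [set z | cabs (z - zeta) < 2^-1].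

End Defs.

(* Main.v *)
Require Import Defs.
From HB Require Import structures.
From mathcomp Require Import all_boot all_order all_algebra.
From mathcomp Require Import all_classical all_reals all_analysis.
From mathcomp Require Import complex.
From mathcomp Require Import measurable_realfun ring lra.
Set Implicit Arguments. Unset Strict Implicit. Unset Printing Implicit Defensive.
Import Order.TTheory GRing.Theory Num.Theory.
Import numFieldNormedType.Exports.
Local Open Scope classical_set_scope.
Local Open Scope ring_scope.

(** Let [d = |zeta - zeta0|]. On a Stolz angle at [zeta0], a point [w] at distance
    [1 - x] from the circle satisfies [1 - x + d <= (2 + sigma) |zeta - w|], so the
    Herglotz kernel is bounded by a multiple of [1 / (1 - x + d)]; by Tonelli, its
    fractional integral of order [g] is bounded by a multiple of [d^(g-1)], which
    gives 3) => 1). Conversely, restrict [psi] to the short arc on one closed side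
    of [zeta0] and approach [zeta0] with [1 - |z| = tau] along points tilted by an
    angle of order [tau] towards the other side: the imaginary part of the kernel
    then has constant sign and is at least of order [1 / D], [D = d + tau], on a
    radial interval of length [D / 4]. Hence its fractional integral is at least of
    order [D^(g-1)], and letting [tau] tend to 0 gives 2) => 3). The tilt also
    covers a possible atom of [psi] at [zeta0], invisible along the radius. *)

(** * Integrals *)

Section integral_without_measurability.
Context (d : measure_display) (T : measurableType d) (R : realType).
Variable mu : {measure set T -> \bar R}.
Implicit Types (D : set T) (f g : T -> \bar R) (u : T -> R).

(** The integral of a nonnegative function is the supremum of those of the simple functions below
    it, which gives monotonicity without measurability. Hence none has to be proved for Herglotz
    transforms along a ray. *)
Lemma ge0_le_integral_any D f g : (forall x, D x -> (0 <= f x)%E) ->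
  (forall x, D x -> (f x <= g x)%E) ->
  (\int[mu]_(x in D) f x <= \int[mu]_(x in D) g x)%E.
Proof.
move=> f0 fg.
rewrite ge0_integralE// ge0_integralE; last first.
  by move=> x Dx; exact: le_trans (f0 x Dx) (fg x Dx).
apply: ereal_sup_le => _ [h/= hf <-]; exists h => //= x.
by apply: le_trans (hf x) _; apply: lee_restrict.
Qed.

(** If the right side is a finite [G], the positive and negative parts of [u] both have integrals in
    [[0, G]], so their difference has modulus at most [G]. *)
Lemma normr_Rintegral_le D u g :
  (forall x, D x -> (`|u x|%:E <= g x)%E) ->
  (`|Rintegral mu D u|%:E <= \int[mu]_(x in D) g x)%E.
Proof.
move=> ug; rewrite /Rintegral integralE.
have p0 : (0 <= \int[mu]_(x in D) (fun x => (u x)%:E)^\+ x)%E.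
  by apply: integral_ge0.
have n0 : (0 <= \int[mu]_(x in D) (fun x => (u x)%:E)^\- x)%E.
  by apply: integral_ge0.
have pg : (\int[mu]_(x in D) (fun x => (u x)%:E)^\+ x <= \int[mu]_(x in D) g x)%E.
  apply: ge0_le_integral_any => // x Dx; apply: le_trans (ug x Dx).
  by rewrite funeposE -EFin_max lee_fin ge_max ler_norm normr_ge0.
have ng : (\int[mu]_(x in D) (fun x => (u x)%:E)^\- x <= \int[mu]_(x in D) g x)%E.
  apply: ge0_le_integral_any => // x Dx; apply: le_trans (ug x Dx).
  by rewrite funenegE -EFinN -EFin_max lee_fin ge_max -normrN ler_norm normr_ge0.
move: p0 n0 pg ng; set P := integral _ _ _; set N := integral _ _ _.
case: (integral mu D g) => [G| |]; last 2 first.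
- by move=> *; rewrite leey.
- by move=> p0 _ /(le_trans p0).
case: P => [p| |]//; case: N => [n| |]//; rewrite /= !lee_fin => p0 n0 pG nG.
by rewrite ler_norml; lra.
Qed.

(** Negation swaps the positive and negative parts, and [fine] sends every infinite difference to 0
    on both sides. *)
Lemma RintegralN_any D u :
  Rintegral mu D (fun x => - u x) = - Rintegral mu D u.
Proof.
rewrite /Rintegral integralE [in RHS]integralE.
have -> : ((fun x => (- u x)%R%:E)^\+ = (fun x => (u x)%:E)^\-)%E.
  by apply/funext => x; rewrite funeposE funenegE.
have -> : ((fun x => (- u x)%R%:E)^\- = (fun x => (u x)%:E)^\+)%E.
  by apply/funext => x; rewrite funeposE funenegE EFinN oppeK.
case: (integral mu D _) => [p| |]; case: (integral mu D _) => [n| |] //=;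
  by rewrite ?oppr0// opprB.
Qed.

(** [M] guarantees finiteness: [fine] would turn an infinite integral of [u] into 0. *)
Lemma integral_le_Rintegral D u f (M : R) : (forall x, D x -> (0 <= f x)%E) ->
  (forall x, D x -> (f x <= (u x)%:E)%E) ->
  (\int[mu]_(x in D) (u x)%:E <= M%:E)%E ->
  (\int[mu]_(x in D) f x <= (Rintegral mu D u)%:E)%E.
Proof.
move=> f0 fu uM; rewrite /Rintegral fineK; last first.
  rewrite ge0_fin_numE ?(le_lt_trans uM) ?ltry//.
  by apply: integral_ge0 => x Dx; exact: le_trans (f0 x Dx) (fu x Dx).
exact: ge0_le_integral_any.
Qed.

(** Meant for arcs closed at [zeta0], which share that point, possibly an atom. *)
Lemma ge0_integral_setU_le (A B : set T) f : measurable A -> measurable B ->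
  measurable_fun setT f -> (forall x, (0 <= f x)%E) ->
  (\int[mu]_(x in A `|` B) f x <=
   \int[mu]_(x in A) f x + \int[mu]_(x in B) f x)%E.
Proof.
move=> mA mB mf f0.
have -> : A `|` B = A `|` (B `\` A) by rewrite setDE setUIr setUCr setIT.
rewrite ge0_integral_setU//.
- rewrite leeD2l//; apply: ge0_subset_integral => //.
  + exact: measurableD.
  + exact: measurable_funTS.
- exact: measurableD.
- exact: measurable_funTS.
- by apply/disj_setPS => x [/= Ax [_ /(_ Ax)]].
Qed.

End integral_without_measurability.

(** As [m1] lives on [D], comparing the two measures on subsets of [D] compares them on all
    measurable sets. This passes from [chi] to [psi]. *)
Lemma ge0_integral_le_measure (d : measure_display) (T : measurableType d) (R : realType)
    (m1 m2 : {measure set T -> \bar R}) (D : set T) (f : T -> \bar R) :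
  measurable D -> m1 (~` D) = 0%E ->
  (forall A, measurable A -> A `<=` D -> (m1 A <= m2 A)%E) ->
  measurable_fun setT f -> (forall x, (0 <= f x)%E) ->
  (\int[m1]_(x in D) f x <= \int[m2]_(x in D) f x)%E.
Proof.
move=> mD m1D m12 mf f0; apply: ge0_le_measure_integral => // S mS.
have mSD := measurableI _ _ mS mD.
have SD0 : m1 (S `\` D) = 0%E.
  apply: subset_measure0 m1D => //; [exact: measurableD|exact: measurableC].
have -> : m1 S = (m1 (S `\` D) + m1 (S `&` D))%E by exact: measureDI.
rewrite SD0 add0e; apply: le_trans (m12 _ mSD (@subIsetr _ _ _)) _.
by apply: le_measure; rewrite ?inE.
Qed.

Lemma measurable_funV (d : measure_display) (T : measurableType d) (R : realType)
    (f : T -> R) : measurable_fun setT f -> measurable_fun setT (fun x => (f x)^-1).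
Proof.
(* The square keeps the base of the power nonnegative; at a zero of [f] both sides are 0. *)
move=> mf; have -> : (fun x => (f x)^-1) = (fun x => f x * ((f x ^+ 2) `^ (-1))).
  apply/funext => x; rewrite powR_inv1 ?sqr_ge0//.
  have [->|fx0] := eqVneq (f x) 0; first by rewrite invr0 mul0r.
  by field.
apply: measurable_funM => //.
by apply: (measurableT_comp (@measurable_powR R _)); exact: measurable_funX.
Qed.

Lemma measurable_fun_sqrt (d : measure_display) (T : measurableType d) (R : realType)
    (f : T -> R) : (forall x, 0 <= f x) ->
  measurable_fun setT f -> measurable_fun setT (fun x => Num.sqrt (f x)).
Proof.
move=> f0 mf; have -> : (fun x => Num.sqrt (f x)) = (fun x => f x `^ 2^-1).
  by apply/funext => x; rewrite powR12_sqrt.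
exact: (measurableT_comp (@measurable_powR R _)).
Qed.

(** * Tonelli's theorem on a rectangle *)

Section fubini_tonelli_in.
Context (d1 d2 : measure_display) (T1 : measurableType d1) (T2 : measurableType d2).
Context (R : realType) (m1 : {sigma_finite_measure set T1 -> \bar R}).
Variable m2 : {measure set T2 -> \bar R}.
Hypothesis m2fin : fin_num_fun m2.

Lemma fubini_tonelli_in (A : set T1) (B : set T2) (f : T1 * T2 -> \bar R) :
  measurable A -> measurable B -> measurable_fun setT f -> (forall x, (0 <= f x)%E) ->
  (\int[m1]_(x in A) \int[m2]_(y in B) f (x, y) =
   \int[m2]_(y in B) \int[m1]_(x in A) f (x, y))%E.
Proof.
move=> mA mB mf f0.
(* Finiteness of the plain measure [m2] supplies the sigma-finite structure that Tonelli's theorem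
   asks for; extension by 0 then reduces the rectangle to the whole product. *)
have sf : sigma_finite setT m2 by apply: fin_num_fun_sigma_finite; rewrite ?measure0.
pose H1 := isSFinite.Build _ _ _ _ (@sfinite_measure_sigma_finite _ _ _ m2 sf).
pose H2 := isSigmaFinite.Build _ _ _ _ sf.
pose m2' := HB.pack_for (SigmaFiniteMeasure.type T2 R) (Measure.sort m2) H1 H2.
pose F := f \_ (A `*` B).
have mF : measurable_fun setT F.
  apply/(measurable_restrictT _ _).1; first exact: measurableX.
  exact: measurable_funTS.
have F0 x : (0 <= F x)%E by apply: erestrict_ge0.
have := @fubini_tonelli _ _ _ _ _ m1 m2' F mF F0.
rewrite /F => E; transitivity (\int[m1]_x \int[m2]_y (f \_ (A `*` B)) (x, y))%E.
  rewrite integral_mkcond; apply: eq_integral => x _.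
  rewrite patchE; case: ifPn => xA.
    rewrite integral_mkcond; apply: eq_integral => y _.
    by rewrite !patchE in_setX/= xA.
  rewrite integral0_eq// => y _; by rewrite patchE in_setX/= (negbTE xA).
rewrite E [RHS]integral_mkcond; apply: eq_integral => y _.
rewrite patchE; case: ifPn => yB.
  rewrite [RHS]integral_mkcond; apply: eq_integral => x _.
  by rewrite !patchE in_setX/= yB andbT.
by rewrite integral0_eq// => x _; rewrite patchE in_setX/= (negbTE yB) andbF.
Qed.

End fubini_tonelli_in.

(** * Integrals of powers, and positivity of [Gamma] *)

Section power_integrals.
Context {R : realType}.
Notation mu := (@lebesgue_measure R).

Lemma powR_antimono (e x y : R) : e <= 0 -> 0 < x -> x <= y -> y `^ e <= x `^ e.
Proof.
move=> e0 x0 xy; have y0 := lt_le_trans x0 xy.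
rewrite -[e]opprK (powRN y) (powRN x) lef_pV2 ?posrE ?powR_gt0//.
by rewrite (@ge0_ler_powR _ (- e)) ?nnegrE ?oppr_ge0// ltW.
Qed.

Lemma is_derive_powR_sub (e r x : R) : e != 0 -> x < r ->
  is_derive x 1 (fun y => - e^-1 * (r - y) `^ e) ((r - x) `^ (e - 1)).
Proof.
move=> e0 xr.
have h1 : is_derive x 1 (fun y => r - y) (-1).
  by apply: is_derive_eq (is_deriveB (is_derive_cst r x 1) (is_derive_id x 1)) _; rewrite sub0r.
have rx : 0 < r - x by rewrite subr_gt0.
have h2 : is_derive (r - x) 1 (fun y => y `^ e) (e * (r - x) `^ (e - 1)).
  exact: is_derive1_powR.
have h3 := is_derive1_comp (f := fun y => y `^ e) (g := fun y => r - y) h2 h1.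
have h4 := is_deriveZ (- e^-1) h3.
apply: is_derive_eq h4 _.
by rewrite /GRing.scale/=; field.
Qed.

Lemma continuous_powR_sub (e r x : R) : x < r ->
  {for x, continuous (fun y : R => (r - y) `^ e)}.
Proof.
move=> xr; have [->|e0] := eqVneq e 0.
  have -> : (fun y : R => (r - y) `^ 0) = cst 1 by apply/funext => y; rewrite powRr0.
  exact: cst_continuous.
have h := is_derive_powR_sub e0 xr.
have -> : (fun y : R => (r - y) `^ e) = (fun y => - e * (- e^-1 * (r - y) `^ e)).
  by apply/funext => y; field.
apply: continuousM; first exact: cst_continuous.
apply: differentiable_continuous; apply/derivable1_diffP.
exact: ex_derive.
Qed.

Lemma integral_powR_sub (e a b r : R) : e != 0 -> a < b -> b < r ->
  (\int[mu]_(x in `[a, b]) ((r - x) `^ (e - 1))%:E =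
   (((r - a) `^ e - (r - b) `^ e) / e)%:E)%E.
Proof.
move=> e0 ab br.
pose F y := - e^-1 * (r - y) `^ e.
have cF x : x < r -> {for x, continuous F}.
  move=> xr; apply: differentiable_continuous; apply/derivable1_diffP.
  exact/ex_derive/is_derive_powR_sub.
rewrite (@continuous_FTC2 _ _ F)//.
- by rewrite -EFinB; congr EFin; rewrite /F; field.
- apply: continuous_in_subspaceT => x /set_mem/=; rewrite in_itv/= => /andP[_ xb].
  by apply: continuous_powR_sub; exact: le_lt_trans br.
- split.
  + move=> x; rewrite in_itv/= => /andP[_ xb].
    exact/ex_derive/is_derive_powR_sub/(lt_trans xb).
  + by apply: cvg_at_right_filter; apply: cF; exact: lt_trans br.
  + by apply: cvg_at_left_filter; apply: cF.
- move=> x; rewrite in_itv/= => /andP[_ xb]; rewrite derive1E.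
  by apply: derive_val; apply: is_derive_powR_sub => //; exact: lt_trans br.
Qed.

Lemma integral_powR_sub_sing (g a r : R) : 0 < g -> a < r ->
  (\int[mu]_(x in `[a, r]) ((r - x) `^ (g - 1))%:E <= ((r - a) `^ g / g)%:E)%E.
Proof.
move=> g0 ar.
have mf (D : set R) : measurable_fun D (fun x : R => ((r - x) `^ (g - 1))%:E).
  apply/measurable_EFinP; apply: measurable_funTS.
  by apply: (measurableT_comp (@measurable_powR R _)); exact: measurable_funB.
rewrite -integral_itv_bndo_bndc; last exact: mf.
(* The truncations avoid the singularity at [r]; [n.+2] rather than [n.+1] keeps the first interval
   nondegenerate. *)
pose F n : set R := `[a, r - (r - a) / n.+2%:R]%classic.
have ra : 0 < r - a by rewrite subr_gt0.
have -> : `[a, r[%classic = \bigcup_n F n.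
  apply/seteqP; split=> x/=; rewrite ?in_itv/=.
    move=> /andP[ax xr]; have rx : 0 < r - x by rewrite subr_gt0.
    have [n _ hn] := near_infty_natSinv_lt (PosNum (divr_gt0 rx ra)).
    exists n => //; rewrite /F/= in_itv/= ax/=.
    have /= := hn n.+1 (leqnSn _).
    by rewrite ltr_pdivlMr//; move: (_^-1) => i h; rewrite lerBrDr -lerBrDl; rewrite mulrC; lra.
  move=> [n _]; rewrite /F/= in_itv/= => /andP[-> xn]/=.
  apply: le_lt_trans xn _; rewrite ltrBlDr ltrDl; exact: divr_gt0.
have ndF : nondecreasing_seq F.
  move=> n m nm; rewrite subsetEset /F; apply: subset_itvl; rewrite bnd_simp.
  rewrite lerB// ler_wpM2l ?(ltW ra)// lef_pV2 ?posrE//.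
  by rewrite ler_nat !ltnS.
have cv : (\int[mu]_(x in F i) ((r - x) `^ (g - 1))%:E)%E @[i --> \oo] -->
    (\int[mu]_(x in \bigcup_i F i) ((r - x) `^ (g - 1))%:E)%E.
  apply: ge0_nondecreasing_set_cvg_integral => //.
  - by move=> i; exact: measurable_itv.
  - by move=> i; exact: mf.
  - by move=> i x _; rewrite lee_fin powR_ge0.
have <- := cvg_lim _ cv => //.
apply: lime_le; first by apply/cvg_ex; eexists; exact: cv.
(* Each truncated integral is explicit, and its subtracted endpoint term is dropped. *)
apply: nearW => n; rewrite integral_powR_sub ?gt_eqF//.
- by rewrite lee_fin ler_pM2r ?invr_gt0// gerBl powR_ge0.
- rewrite ltrBrDl -ltrBrDr gtr_pMr// invf_lt1//.
  by rewrite ltr1n.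
- by rewrite ltrBlDr ltrDl; exact: divr_gt0.
Qed.

Lemma measurable_powR_sub (e r : R) (D : set R) :
  measurable_fun D (fun x : R => (r - x) `^ e).
Proof.
apply: measurable_funTS; apply: (measurableT_comp (@measurable_powR R _)).
exact: measurable_funB.
Qed.

(* Split at [x = r - d]: the factor [r - x + d] is at least [d] to the right of
   this point and at least [r - x] to the left. *)
Lemma integral_powR_sub_kernel_le (g r d : R) : 0 < g -> g < 1 -> 0 < r -> 0 < d ->
  (\int[mu]_(x in `[0%R, r]) ((r - x) `^ (g - 1) / (r - x + d))%:E <=
   ((g^-1 + (1 - g)^-1) * d `^ (g - 1))%:E)%E.
Proof.
move=> g0 g1 r0 d0.
have mk (D : set R) :
    measurable_fun D (fun x : R => ((r - x) `^ (g - 1) / (r - x + d))%:E).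
  apply/measurable_EFinP; apply: measurable_funM; first exact: measurable_powR_sub.
  apply: measurable_funTS; apply: measurable_funV; apply: measurable_funD => //.
  exact: measurable_funB.
have k0 x : (0 <= x <= r)%R -> (0 <= ((r - x) `^ (g - 1) / (r - x + d))%:E)%E.
  move=> /andP[_ xr]; rewrite lee_fin divr_ge0 ?powR_ge0// addr_ge0 ?(ltW d0)//.
  by rewrite subr_ge0.
(* Used with [a = 0] when [r <= d] and with [a = r - d] otherwise. *)
have near_part (a : R) : 0 <= a -> a < r -> r - a <= d ->
    (\int[mu]_(x in `[a, r]) ((r - x) `^ (g - 1) / (r - x + d))%:E <=
     (g^-1 * d `^ (g - 1))%:E)%E.
  move=> a0 ar ad.
  have ra0 : 0 <= r - a by rewrite subr_ge0 ltW.
  apply: (@le_trans _ _ (\int[mu]_(x in `[a, r]) (d^-1%:E * ((r - x) `^ (g - 1))%:E))%E).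
    apply: ge0_le_integral_any => x /=; rewrite in_itv/= => /andP[ax xr].
      by apply: k0; rewrite xr (le_trans a0).
    rewrite -EFinM lee_fin mulrC ler_wpM2r ?powR_ge0// lef_pV2 ?posrE//; lra.
  rewrite ge0_integralZl_EFin//; last 3 first.
  - by move=> x _; rewrite lee_fin powR_ge0.
  - by apply/measurable_EFinP; exact: measurable_powR_sub.
  - by rewrite invr_ge0 ltW.
  apply: (@le_trans _ _ (d^-1%:E * ((r - a) `^ g / g)%:E)%E).
    by rewrite lee_wpmul2l ?lee_fin ?invr_ge0 ?(ltW d0)//; exact: integral_powR_sub_sing.
  rewrite -EFinM lee_fin.
  have -> : d `^ (g - 1) = d^-1 * d `^ g.
    rewrite powRB; last by rewrite (gt_eqF d0) implybT.
    by rewrite powRr1 ?ltW// mulrC.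
  have -> : d^-1 * ((r - a) `^ g / g) = g^-1 * (d^-1 * (r - a) `^ g).
    by rewrite [LHS]mulrA [LHS]mulrC.
  rewrite ler_wpM2l ?invr_ge0 ?(ltW g0)// ler_wpM2l ?invr_ge0 ?(ltW d0)//.
  by rewrite (@ge0_ler_powR _ g) ?nnegrE// ltW.
have [rd|dr] := leP r d.
  apply: le_trans (near_part 0 _ _ _) _ => //; first by rewrite subr0.
  rewrite lee_fin ler_wpM2r ?powR_ge0// lerDl invr_ge0 subr_ge0 ltW//.
have -> : `[0, r]%classic = `[0, r - d]%classic `|` `]r - d, r]%classic.
  rewrite -itv_bndbnd_setU// bnd_simp; lra.
rewrite ge0_integral_setU//=; last 3 first.
- exact: mk.
- move=> x [] /=; rewrite !in_itv/= => /andP[x0 xr]; apply: k0; lra.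
- by apply/disj_setPS => x [/=]; rewrite !in_itv/= => /andP[_ h1] /andP[h2 _]; lra.
rewrite mulrDl EFinD [leLHS]addeC; apply: leeD.
  have np : (\int[mu]_(x in `[(r - d)%R, r]) ((r - x) `^ (g - 1) / (r - x + d))%:E <=
      (g^-1 * d `^ (g - 1))%:E)%E by apply: near_part; lra.
  apply: le_trans np.
  apply: ge0_subset_integral;
    [exact: measurable_itv|exact: measurable_itv|exact: mk| |].
  - by move=> x/=; rewrite in_itv/= => /andP[x0 xr]; apply: k0; lra.
  - by apply: subset_itvr; rewrite bnd_simp.
apply: (@le_trans _ _ (\int[mu]_(x in `[0%R, (r - d)%R]) ((r - x) `^ ((g - 1) - 1))%:E)%E).
  apply: ge0_le_integral_any => x /=; rewrite in_itv/= => /andP[x0 xr].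
    by apply: k0; lra.
  have rx : 0 < r - x by lra.
  rewrite lee_fin [leRHS]powRB; last by rewrite (gt_eqF rx) implybT.
  rewrite powRr1 ?(ltW rx)// ler_wpM2l ?powR_ge0// lef_pV2 ?posrE//; lra.
(* Here the antiderivative has the negative exponent [g - 1]: the value is
   [(d^(g-1) - r^(g-1)) / (1 - g)], whose subtracted term is dropped. *)
rewrite integral_powR_sub; [|lra|lra|lra].
rewrite lee_fin subr0 opprB addrCA subrr addr0.
rewrite -[leLHS]opprK -mulrN -invrN opprB -mulNr opprB mulrC.
rewrite ler_wpM2l ?invr_ge0 ?subr_ge0 ?(ltW g1)// gerBl powR_ge0//.
Qed.

(** [Gamma] is a [fine] value, 0 for an infinite integral, so finiteness must be shown as well: the
    integrand is dominated by [t^(g-1)] on []0, 1]] and by the exponential density, of total mass 1,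
    on []1, +oo[]. *)
Lemma Gamma_gt0 (g : R) : 0 < g -> g < 1 -> 0 < Gamma g.
Proof.
move=> g0 g1; rewrite /Gamma /Rintegral.
pose f (t : R) := t `^ (g - 1) * expR (- t).
have mf (D : set R) : measurable_fun D (fun t => (f t)%:E).
  apply/measurable_EFinP; apply: measurable_funTS; apply: measurable_funM.
    exact: measurable_powR.
  apply: (measurableT_comp (@measurable_expR R)); exact: oppr_measurable.
have f0 (t : R) : (0 <= (f t)%:E)%E by rewrite lee_fin mulr_ge0 ?powR_ge0 ?expR_ge0.
have fle (t : R) : 0 <= t -> t <= 1 -> f t <= t `^ (g - 1).
  by move=> t0 t1; rewrite ler_piMr ?powR_ge0// -expR0 ler_expR oppr_le0.
have E : `]0, +oo[%classic = `]0, 1]%classic `|` `]1, +oo[%classic :> set R.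
  by rewrite -itv_bndbnd_setU// bnd_simp.
apply: fine_gt0; apply/andP; split.
  apply: (@lt_le_trans _ _ (\int[mu]_(t in `]0%R, 1%R]) (cst (expR (-1))%:E) t)%E).
    rewrite integral_cst//= lebesgue_measure_itv/= lte_fin ltr01 oppr0 adde0 mule1.
    by rewrite lte_fin expR_gt0.
  apply: (@le_trans _ _ (\int[mu]_(t in `]0%R, 1%R]) (f t)%:E)%E); last first.
    apply: ge0_subset_integral;
      [exact: measurable_itv|exact: measurable_itv|exact: mf|by move=> ? _; exact: f0|].
    by rewrite E; exact: subsetUl.
  apply: ge0_le_integral_any => t/=; rewrite in_itv/= => /andP[t0 t1].
    by rewrite lee_fin expR_ge0.
  rewrite lee_fin /f -[leLHS]mul1r ler_pM ?expR_ge0//; last by rewrite ler_expR lerN2.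
  by rewrite -[leLHS](congr1 (fun f => f (g - 1)) (powR1 R)) powR_antimono// subr_le0 ltW.
rewrite E ge0_integral_setU//=; last 3 first.
- exact: mf.
- by move=> x _; exact: f0.
- by apply/disj_setPS => x [/=]; rewrite !in_itv/= => /andP[_ h1] /andP[h2 _]; lra.
apply: lte_add_pinfty.
  apply: (@le_lt_trans _ _ (\int[mu]_(t in `[0%R, 1%R]) (t `^ (g - 1))%:E)%E).
    apply: (@le_trans _ _ (\int[mu]_(t in `[0%R, 1%R]) (f t)%:E)%E).
      apply: ge0_subset_integral;
        [exact: measurable_itv|exact: measurable_itv|exact: mf|by move=> ? _; exact: f0|].
      by apply: subset_itvr; rewrite bnd_simp.
    apply: ge0_le_integral_any => t/=; first by move=> _; exact: f0.
    by rewrite in_itv/= => /andP[t0 t1]; rewrite lee_fin; exact: fle.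
  have mp : measurable_fun setT (fun t : R => (t `^ (g - 1))%:E).
    by apply/measurable_EFinP; exact: measurable_powR.
  (* Reflection moves the singularity from 0 as left endpoint to the right endpoint, where
     [integral_powR_sub_sing] applies. *)
  have -> : (\int[mu]_(t in `[0%R, 1%R]) (t `^ (g - 1))%:E =
             \int[mu]_(t in `[(-1)%R, 0%R]) ((0 - t) `^ (g - 1))%:E)%E.
    transitivity (\int[pushforward mu (-%R : _ -> measurableTypeR R)]_(t in `[0%R, 1%R])
        (t `^ (g - 1))%:E)%E.
      by apply: eq_measure_integral => A mA _; exact/esym/lebesgue_measureN.
    rewrite ge0_integral_pushforward//; last 2 first.
    - exact: measurable_funTS.
    - by move=> t _; rewrite lee_fin powR_ge0.
    rewrite opp_preimage_itvbndbnd/= oppr0.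
    by apply: eq_integral => t _ /=; rewrite sub0r.
  apply: le_lt_trans (integral_powR_sub_sing g0 _) _; [lra|exact: ltry].
apply: le_lt_trans (ltry 1); rewrite -(integral_exponential_pdf (ltr01 : 0 < 1 :> R)).
apply: (@le_trans _ _ (\int[mu]_(t in `]1%R, +oo[) (exponential_pdf 1 t)%:E)%E).
  apply: ge0_le_integral_any => t/=; first by move=> _; exact: f0.
  rewrite in_itv/= andbT => t1.
  rewrite lee_fin exponential_pdfE; last by rewrite ltW// (lt_trans ltr01).
  rewrite mul1r mulN1r ler_piMl ?expR_ge0//.
  rewrite -[leRHS](powRr0 t) ler_powR ?subr_le0 ?ltW//.
apply: ge0_subset_integral => //.
- by apply/measurable_EFinP; exact: measurable_exponential_pdf.
- by move=> x _; rewrite lee_fin exponential_pdf_ge0.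
Qed.

End power_integrals.

(** * The Herglotz kernel *)

Section complex_modulus.
Context {R : realType}.
Implicit Types (z w : R[i]) (p : R * R).

Lemma cabsE w : cabs w = Normc.normc w.
Proof. by case: w. Qed.

Lemma cabs_ge0 w : 0 <= cabs w.
Proof. exact: sqrtr_ge0. Qed.

Lemma cabsM z w : cabs (z * w) = cabs z * cabs w.
Proof. by rewrite !cabsE Normc.normcM. Qed.

Lemma cabsV w : cabs w^-1 = (cabs w)^-1.
Proof. by rewrite !cabsE Normc.normcV. Qed.

Lemma cabsN w : cabs (- w) = cabs w.
Proof. by case: w => a b; rewrite /cabs/= !sqrrN. Qed.

Lemma cabs_distC z w : cabs (z - w) = cabs (w - z).
Proof. by rewrite -cabsN opprB. Qed.

Lemma cabs_conj w : cabs (conjc w) = cabs w.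
Proof. by case: w => a b; rewrite /cabs/= sqrrN. Qed.

Lemma cabs_real (x : R) : 0 <= x -> cabs (x%:C)%C = x.
Proof. by move=> x0; rewrite /cabs/= expr0n addr0 sqrtr_sqr ger0_norm. Qed.

Lemma le_cabsD z w : cabs (z + w) <= cabs z + cabs w.
Proof. by rewrite !cabsE le_normcD. Qed.

Lemma le_cabs_dist z w v : cabs (z - v) <= cabs (z - w) + cabs (w - v).
Proof. by rewrite -{1}(subrK w z) -addrA le_cabsD. Qed.

Lemma cabs_eq0 w : cabs w = 0 -> w = 0.
Proof. by rewrite cabsE => /Normc.eq0_normc. Qed.

Lemma cabs_sqr w : cabs w ^+ 2 = complex.Re w ^+ 2 + complex.Im w ^+ 2.
Proof. by rewrite sqr_sqrtr// addr_ge0// sqr_ge0. Qed.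

Lemma le_cabs_sqr w (x : R) : 0 <= x ->
  complex.Re w ^+ 2 + complex.Im w ^+ 2 <= x ^+ 2 -> cabs w <= x.
Proof.
by move=> x0 h; rewrite -(ger0_norm x0) -sqrtr_sqr ler_wsqrtr.
Qed.

Lemma normr_Re_le_cabs w : `|complex.Re w| <= cabs w.
Proof. by rewrite -sqrtr_sqr ler_wsqrtr// lerDl sqr_ge0. Qed.

Lemma normr_Im_le_cabs w : `|complex.Im w| <= cabs w.
Proof. by rewrite -sqrtr_sqr ler_wsqrtr// lerDr sqr_ge0. Qed.

Lemma cabs_le_ReIm w : cabs w <= `|complex.Re w| + `|complex.Im w|.
Proof.
apply: le_cabs_sqr; first by rewrite addr_ge0.
rewrite sqrrD !real_normK ?num_real// lerD2r lerDl.
by rewrite mulrn_wge0// mulr_ge0.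
Qed.

Lemma cabs_unit_circle p : unit_circle p -> cabs (toC p) = 1.
Proof. by rewrite /unit_circle/= /cabs/= => ->; rewrite sqrtr1. Qed.

(** Puts the Stolz condition in the form [|z - zeta| <= sigma (1 - |z|)]. *)
Lemma cabs_sub_conj (zeta z : R[i]) : cabs zeta = 1 ->
  cabs (1 - z * conjc zeta) = cabs (z - zeta).
Proof.
move=> h; have zz : zeta * conjc zeta = 1.
  move: h; rewrite -[RHS]sqrtr1 /cabs => /eqP.
  rewrite eqr_sqrt ?addr_ge0 ?sqr_ge0//; case: zeta => a b /= /eqP ab.
  by rewrite /GRing.mul/=; congr Complex; rewrite -?ab; ring.
have -> : 1 - z * conjc zeta = (zeta - z) * conjc zeta by rewrite mulrBl zz.
by rewrite cabsM cabs_conj h mulr1 cabs_distC.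
Qed.

(** The Herglotz kernel with pole at [p]. *)
Definition cayley p w : R[i] := (toC p + w) / (toC p - w).

Lemma one_sub_le_cabs p w : unit_circle p -> 1 - cabs w <= cabs (toC p - w).
Proof.
move=> /cabs_unit_circle p1; rewrite lerBlDr -p1.
by rewrite -{1}(subrK w (toC p)) le_cabsD.
Qed.

Lemma cabs_cayley_le p w : unit_circle p -> cabs w < 1 ->
  cabs (cayley p w) <= 2 / cabs (toC p - w).
Proof.
move=> p1 w1; rewrite /cayley cabsM cabsV ler_wpM2r ?invr_ge0 ?cabs_ge0//.
by apply: le_trans (le_cabsD _ _) _; rewrite cabs_unit_circle//; lra.
Qed.

(** The numerator is twice the imaginary part of [w] times the conjugate of [p]: its sign tells on
    which side of the direction [p] the point [w] lies. *)
Lemma Im_cayley p w : complex.Im (cayley p w) =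
  2 * (complex.Im w * p.1 - complex.Re w * p.2) / cabs (toC p - w) ^+ 2.
Proof.
rewrite cabs_sqr /cayley; case: p w => [a b] [u v] /=.
set n := (a - u) ^+ 2 + (b - v) ^+ 2.
transitivity ((a + u) * - ((b - v) / n) + (b + v) * ((a - u) / n)); first by [].
by ring.
Qed.

Lemma cabs_ray z (x : R) : 0 < cabs z -> 0 <= x ->
  cabs (((x / cabs z)%:C)%C * z) = x.
Proof.
move=> z0 x0; rewrite cabsM cabs_real ?divr_ge0 ?cabs_ge0//.
by rewrite divfK// gt_eqF.
Qed.

(** Let [w] be the point of modulus [x] on the ray and [A = |p - w|]. Going from [zeta0] to [p]
    through [z] and [w] costs at most [sigma (1 - |z|) + (|z| - x) + A]. As [sigma > 1], the first
    two terms sum to at most [sigma (1 - x)], and [1 - x <= A]. *)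
Lemma stolz_ray_dist (sigma : R) (zeta0 : R[i]) z p (x : R) :
  cabs zeta0 = 1 -> 1 < sigma -> stolz sigma zeta0 z -> 0 < cabs z ->
  0 <= x -> x <= cabs z -> unit_circle p ->
  (1 - x) + cabs (zeta0 - toC p) <=
    (2 + sigma) * cabs (toC p - ((x / cabs z)%:C)%C * z).
Proof.
move=> h0 s1 [z1]; rewrite cabs_sub_conj// => zs z0 x0 xz p1.
set w := (X in toC p - X).
have wx : cabs w = x by exact: cabs_ray.
have h1 := one_sub_le_cabs w p1.
have h2 : cabs (z - w) = cabs z - x.
  have -> : z - w = ((1 - x / cabs z)%:C)%C * z.
    by rewrite rmorphB/= mulrBl mul1r.
  rewrite cabsM cabs_real; last by rewrite subr_ge0 ler_pdivrMr// mul1r.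
  by rewrite mulrBl mul1r divfK// gt_eqF.
have h3 := le_cabs_dist zeta0 z (toC p).
have h4 := le_cabs_dist z w (toC p).
rewrite (cabs_distC zeta0 z) in h3; rewrite (cabs_distC w) in h4.
rewrite wx in h1; move: h1 h2 h3 h4 zs.
move: (cabs (toC p - w)) (cabs (zeta0 - toC p)) (cabs (z - toC p)) (cabs (z - w)) (cabs (z - zeta0)).
by move=> A d e f k h1 h2 h3 h4 zs; nra.
Qed.

End complex_modulus.

(** * Arcs on one side of [zeta0] and points tilted to the other side *)

Section side_arcs.
Context {R : realType}.
Variable zeta0 : R[i].
Hypothesis zeta0_unit : cabs zeta0 = 1.
Implicit Types (p : R * R) (eps tau x : R).

(** The two linear forms are the cosine and the sine of the angle from [zeta0] to [p]. The arc thus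
    spans an angle of [pi / 3] from [zeta0], endpoint included, on the side opposite to the tilt of
    sign [eps]. *)
Definition side_arc eps : set (R * R) := [set p | unit_circle p /\
  2^-1 <= complex.Re zeta0 * p.1 + complex.Im zeta0 * p.2 /\
  eps * (complex.Re zeta0 * p.2 - complex.Im zeta0 * p.1) <= 0].

(* [zeta0] rotated by the angle [2 * eps * atan tau] (for [eps = 1] or [-1]); the
   rational parametrization avoids square roots. *)
Definition tilted eps tau : R[i] :=
  ((1 - tau ^+ 2) / (1 + tau ^+ 2) +i* (eps * (2 * tau / (1 + tau ^+ 2))))%C * zeta0.

Lemma zeta0_sqr : complex.Re zeta0 ^+ 2 + complex.Im zeta0 ^+ 2 = 1.
Proof. by rewrite -cabs_sqr zeta0_unit expr1n. Qed.

Lemma cabs_tilted eps tau : eps ^+ 2 = 1 -> cabs (tilted eps tau) = 1.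
Proof.
move=> e1; rewrite cabsM zeta0_unit mulr1 /cabs/=.
have t0 : 1 + tau ^+ 2 != 0 by rewrite gt_eqF// ltr_pwDl// sqr_ge0.
rewrite (_ : _ + _ = 1) ?sqrtr1// [(eps * _) ^+ 2]exprMn e1.
by field.
Qed.

Lemma cabs_tilted_sub eps tau : eps ^+ 2 = 1 -> 0 <= tau ->
  cabs (zeta0 - tilted eps tau) <= 2 * tau.
Proof.
move=> e1 t0; rewrite /tilted -{1}[zeta0]mul1r -mulrBl cabsM zeta0_unit mulr1.
have t1 : 0 < 1 + tau ^+ 2 by rewrite ltr_pwDl// sqr_ge0.
have tn : 1 + tau ^+ 2 != 0 by rewrite gt_eqF.
apply: le_cabs_sqr => /=; first by rewrite mulr_ge0.
rewrite sub0r sqrrN [(eps * _) ^+ 2]exprMn e1 mul1r.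
have -> : (1 - (1 - tau ^+ 2) / (1 + tau ^+ 2)) ^+ 2 + (2 * tau / (1 + tau ^+ 2)) ^+ 2 =
   (2 * tau) ^+ 2 / (1 + tau ^+ 2) by field.
rewrite ler_pdivrMr// ler_peMr ?sqr_ge0//.
by rewrite lerDl sqr_ge0.
Qed.

Lemma cabs_scaled_tilted_sub eps tau x : eps ^+ 2 = 1 -> 0 <= tau -> x <= 1 ->
  cabs (zeta0 - (x%:C)%C * tilted eps tau) <= 2 * tau + (1 - x).
Proof.
move=> e1 t0 x1; apply: le_trans (le_cabs_dist _ (tilted eps tau) _) _.
rewrite lerD ?cabs_tilted_sub//.
have -> : tilted eps tau - (x%:C)%C * tilted eps tau = ((1 - x)%:C)%C * tilted eps tau.
  by rewrite rmorphB/= mulrBl mul1r.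
by rewrite cabsM cabs_tilted// mulr1 cabs_real// subr_ge0.
Qed.

(** The distance to [zeta0] is at most [2 tau] for the tilt plus [tau] for the radius, so aperture 4
    suffices, and [3 / 8 < 1 / 2] places the point in the truncated angle. *)
Lemma tilted_stolz eps tau : eps ^+ 2 = 1 -> 0 < tau -> tau <= 8^-1 ->
  stolz_star 4 zeta0 (((1 - tau)%:C)%C * tilted eps tau).
Proof.
move=> e1 t0 t8.
have h := cabs_scaled_tilted_sub e1 (ltW t0) (_ : 1 - tau <= 1).
have {}h : cabs (zeta0 - ((1 - tau)%:C)%C * tilted eps tau) <= 3 * tau.
  by apply: le_trans (h _) _; lra.
have cz : cabs (((1 - tau)%:C)%C * tilted eps tau) = 1 - tau.
  by rewrite cabsM cabs_tilted// mulr1 cabs_real//; lra.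
rewrite cabs_distC in h.
split; first split; rewrite /= ?cabs_sub_conj// ?cz; lra.
Qed.

Lemma cabs_dist_sqr p : unit_circle p ->
  cabs (zeta0 - toC p) ^+ 2 = 2 - 2 * (complex.Re zeta0 * p.1 + complex.Im zeta0 * p.2).
Proof.
rewrite /unit_circle/= => p1.
transitivity ((complex.Re zeta0 ^+ 2 + complex.Im zeta0 ^+ 2) + (p.1 ^+ 2 + p.2 ^+ 2) -
    2 * (complex.Re zeta0 * p.1 + complex.Im zeta0 * p.2)).
  rewrite cabs_sqr; case: (zeta0) => a0 b0 /=; ring.
by rewrite p1 zeta0_sqr.
Qed.

(** With [d^2 = 2 - 2c] and [c >= 1/2], [s^2 = (1 - c) (1 + c)] is at least [3 d^2 / 4]; [5 / 4] is
    a rational upper bound for [2 / sqrt 3]. *)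
Lemma side_arc_dist eps p : eps ^+ 2 = 1 -> side_arc eps p ->
  let c := complex.Re zeta0 * p.1 + complex.Im zeta0 * p.2 in
  let s := complex.Re zeta0 * p.2 - complex.Im zeta0 * p.1 in
  cabs (zeta0 - toC p) <= 1 /\ 4 * cabs (zeta0 - toC p) <= 5 * (- (eps * s)).
Proof.
move=> e1 [p1 [c2 es]] c s; have d2 : _ = 2 - 2 * c := cabs_dist_sqr p1.
move: p1; rewrite /unit_circle/= => p1.
have cs : (eps * s) ^+ 2 = 1 - c ^+ 2.
  rewrite exprMn e1 mul1r.
  have -> : 1 - c ^+ 2 = (complex.Re zeta0 ^+ 2 + complex.Im zeta0 ^+ 2) *
      (p.1 ^+ 2 + p.2 ^+ 2) - c ^+ 2 by rewrite p1 zeta0_sqr mulr1.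
  rewrite /c /s; ring.
have d0 := cabs_ge0 (zeta0 - toC p).
rewrite -/c in c2; rewrite -/s in es.
have c1 : c <= 1 by have := sqr_ge0 (eps * s); nra.
split; first by rewrite -(@ler_pXn2r _ 2) ?nnegrE// expr1n d2; lra.
rewrite -(@ler_pXn2r _ 2) ?nnegrE//; [|by rewrite mulr_ge0|by lra].
rewrite !exprMn sqrrN cs d2; nra.
Qed.

(** In the frame rotated by [zeta0] this is the addition formula for the sine. On the side arc both
    [c] and [- (eps * s)] are nonnegative, so the two terms cannot cancel. *)
Lemma Im_cayley_tilted eps tau p x : eps ^+ 2 = 1 ->
  let c := complex.Re zeta0 * p.1 + complex.Im zeta0 * p.2 in
  let s := complex.Re zeta0 * p.2 - complex.Im zeta0 * p.1 in
  eps * complex.Im (cayley p ((x%:C)%C * tilted eps tau)) =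
  2 * x * (2 * tau / (1 + tau ^+ 2) * c + (1 - tau ^+ 2) / (1 + tau ^+ 2) * - (eps * s)) /
  cabs (toC p - (x%:C)%C * tilted eps tau) ^+ 2.
Proof.
move=> e1 c s; rewrite Im_cayley mulrA; congr (_ / _).
(* Keeping [eps ^+ 2] makes the identity polynomial, within reach of [ring]. *)
transitivity (2 * x * (2 * tau / (1 + tau ^+ 2) * c * eps ^+ 2 +
    (1 - tau ^+ 2) / (1 + tau ^+ 2) * - (eps * s))); last by rewrite e1 mulr1.
rewrite /c /s /tilted.
move: (2 * tau / _) ((1 - _) / _) => w2 w1.
case: (zeta0) => a0 b0 /=; ring.
Qed.

Lemma tilted_coefs tau : 0 <= tau -> tau <= 8^-1 ->
  tau <= 2 * tau / (1 + tau ^+ 2) /\ 9 / 10 <= (1 - tau ^+ 2) / (1 + tau ^+ 2).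
Proof.
move=> t0 t8; have t1 : 0 < 1 + tau ^+ 2 by rewrite ltr_pwDl// sqr_ge0.
by split; rewrite ler_pdivlMr//; nra.
Qed.

Lemma Im_cayley_side_ge0 eps tau p x : eps ^+ 2 = 1 -> 0 <= tau -> tau <= 8^-1 ->
  side_arc eps p -> 0 <= x -> 0 <= eps * complex.Im (cayley p ((x%:C)%C * tilted eps tau)).
Proof.
move=> e1 t0 t8 [p1 [c2 es]] x0; rewrite Im_cayley_tilted//.
have [h1 h2] := tilted_coefs t0 t8.
rewrite divr_ge0 ?sqr_ge0// mulr_ge0 ?mulr_ge0// addr_ge0// mulr_ge0//; lra.
Qed.

(** With [D = d + tau], the numerator is at least [D / 2], since [9/10 * 4/5] and [1/2] both reach
    [1/2], and the denominator is at most [(4 D)^2]. *)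
Lemma Im_cayley_side_ge eps tau p x : eps ^+ 2 = 1 -> 0 < tau -> tau <= 8^-1 ->
  side_arc eps p -> x <= 1 - tau ->
  1 - tau - (cabs (zeta0 - toC p) + tau) / 4 <= x ->
  (32 * (cabs (zeta0 - toC p) + tau))^-1 <=
    eps * complex.Im (cayley p ((x%:C)%C * tilted eps tau)).
Proof.
move=> e1 t0 t8 ap xt xD; rewrite Im_cayley_tilted//.
have [d1 ds] := side_arc_dist e1 ap.
have [h1 h2] := tilted_coefs (ltW t0) t8.
move: ap => [p1 [c2 es]].
have d0 := cabs_ge0 (zeta0 - toC p).
have x1 : x <= 1 by lra.
have hq := le_cabs_dist (toC p) zeta0 ((x%:C)%C * tilted eps tau).
have hr := cabs_scaled_tilted_sub e1 (ltW t0) x1.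
rewrite (cabs_distC (toC p) zeta0) in hq.
(* From [d <= 1] and [tau <= 1/8]: [1 - 1/8 - 9/32]. What matters below is [2 x >= 1]. *)
have x0 : 19 / 32 <= x by lra.
have q0 : 0 < cabs (toC p - (x%:C)%C * tilted eps tau).
  apply: lt_le_trans (one_sub_le_cabs _ p1).
  by rewrite cabsM cabs_tilted// mulr1 cabs_real; lra.
have qD : cabs (toC p - (x%:C)%C * tilted eps tau) <= 4 * (cabs (zeta0 - toC p) + tau) by lra.
move: hq hr q0 qD ds c2 es h1 h2 d0 d1 xD => _ _.
move: (cabs (toC p - _)) (cabs (zeta0 - _)) (2 * tau / _) ((1 - _) / _) => q d w2 w1.
move: (eps * _) (- (eps * _)) (_ + _ * p.2) => es e c q0 qD ds c2 _ h1 h2 d0 d1 xD.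
have D0 : 0 < d + tau by lra.
have num : (d + tau) / 2 <= w2 * c + w1 * e by nra.
have num2 : (d + tau) / 2 <= 2 * x * (w2 * c + w1 * e) by nra.
rewrite ler_pdivlMr ?exprn_gt0//; apply: le_trans num2.
rewrite -ler_pdivlMl ?invr_gt0 ?mulr_gt0// invrK.
have -> : 32 * (d + tau) * ((d + tau) / 2) = (4 * (d + tau)) ^+ 2 by field.
by rewrite ler_pXn2r ?nnegrE//; lra.
Qed.

End side_arcs.

(** * Measurability on the circle *)

Section circle_measurability.
Context {R : realType}.
Implicit Types (w : R[i]).

Lemma measurable_Re_toC_sub w :
  measurable_fun setT (fun p : R * R => complex.Re (w - toC p)).
Proof.
have -> : (fun p : R * R => complex.Re (w - toC p)) = (fun p => complex.Re w - p.1).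
  by apply/funext => p; case: w.
by apply: measurable_funB => //; exact: measurable_fst.
Qed.

Lemma measurable_Im_toC_sub w :
  measurable_fun setT (fun p : R * R => complex.Im (w - toC p)).
Proof.
have -> : (fun p : R * R => complex.Im (w - toC p)) = (fun p => complex.Im w - p.2).
  by apply/funext => p; case: w.
by apply: measurable_funB => //; exact: measurable_snd.
Qed.

Lemma measurable_cabs_dist w : measurable_fun setT (fun p : R * R => cabs (w - toC p)).
Proof.
apply: measurable_fun_sqrt => [p|]; first by rewrite addr_ge0// sqr_ge0.
apply: measurable_funD; apply: measurable_funX.
  exact: measurable_Re_toC_sub.
exact: measurable_Im_toC_sub.
Qed.

Lemma measurable_unit_circle : measurable (unit_circle : set (R * R)).
Proof.
rewrite (_ : unit_circle = (fun p => cabs (0 - toC p)) @^-1` [set 1]); last first.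
  apply/seteqP; split=> p; rewrite /unit_circle/= sub0r cabsN.
    by rewrite /cabs => /= ->; rewrite sqrtr1.
  by move=> h; rewrite -[RHS](expr1n _ 2) -h cabs_sqr.
by rewrite -[X in measurable X]setTI; exact: measurable_cabs_dist.
Qed.

Lemma measurable_Im_cayley w :
  measurable_fun setT (fun p : R * R => complex.Im (cayley p w)).
Proof.
under eq_fun do rewrite Im_cayley cabs_distC.
apply: measurable_funM.
  by apply: measurable_funM => //; apply: measurable_funB; apply: measurable_funM.
apply: measurable_funV; apply: measurable_funX; exact: measurable_cabs_dist.
Qed.

Lemma measurable_side_arc (zeta0 : R[i]) (eps : R) : measurable (side_arc zeta0 eps).
Proof.
pose c (p : R * R) := complex.Re zeta0 * p.1 + complex.Im zeta0 * p.2.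
pose s (p : R * R) := eps * (complex.Re zeta0 * p.2 - complex.Im zeta0 * p.1).
have mc : measurable_fun setT c.
  by apply: measurable_funD; apply: measurable_funM.
have ms : measurable_fun setT s.
  by apply: measurable_funM => //; apply: measurable_funB; apply: measurable_funM.
rewrite (_ : side_arc zeta0 eps = unit_circle `&`
   ((setT `&` c @^-1` `[2^-1, +oo[%classic) `&` (setT `&` s @^-1` `]-oo, 0]%classic))).
  apply: measurableI; first exact: measurable_unit_circle.
  by apply: measurableI; [apply: mc|apply: ms].
rewrite !setTI; apply/seteqP; split=> p /=; rewrite !in_itv/= andbT.
  by move=> [? [? ?]].
by move=> [? [? ?]].
Qed.

(** * The integrand of the third condition and its regularization *)

Section reciprocal_distance.
Variables (zeta0 : R[i]) (g : R).
Hypothesis g1 : g < 1.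

(** [inve] gives the value [+oo] at [zeta0], so that an atom there makes the integral infinite. *)
Definition recdist (p : R * R) : \bar R :=
  inve ((cabs (zeta0 - toC p) `^ (1 - g))%:E).

Lemma recdist_ge0 p : (0 <= recdist p)%E.
Proof. by rewrite inve_ge0 lee_fin powR_ge0. Qed.

Lemma recdistE p : 0 < cabs (zeta0 - toC p) ->
  recdist p = (cabs (zeta0 - toC p) `^ (g - 1))%:E.
Proof.
move=> d0; rewrite /recdist inver gt_eqF ?powR_gt0//.
by rewrite -powRN opprB.
Qed.

(** The shift [1 / (n + 8)] is the tilt [tau], at most [1/8] from [n = 0] on. At [zeta0] the terms
    are [(n + 8)^(1-g)], which diverge; elsewhere the power is continuous. *)
Lemma cvg_recdist p :
  ((cabs (zeta0 - toC p) + (n%:R + 8)^-1) `^ (g - 1))%:E @[n --> \oo] --> recdist p.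
Proof.
have n8 : (n%:R + 8 : R) @[n --> \oo] --> +oo.
  apply/cvgryPge => A; near=> n; rewrite -lerBlDr.
  by near: n; move/cvgryPge : (@cvgr_idn R); exact.
have tau0 : ((n%:R + 8)^-1 : R) @[n --> \oo] --> (0 : R).
  by apply/gtr0_cvgV0 => //; near=> n; rewrite ltr_wpDl.
have := cabs_ge0 (zeta0 - toC p); rewrite le_eqVlt => /predU1P[d0|d0].
  rewrite /recdist -d0 powR0 ?subr_eq0 ?gt_eqF// inve0.
  apply/cvgeryP/cvgryPge => A.
  near=> n; rewrite add0r.
  have n0 : 0 < n%:R + 8 :> R by rewrite ltr_wpDl.
  rewrite -opprB powRN -powR_inv1; last exact: powR_ge0.
  rewrite -powR_inv1 ?(ltW n0)// -!powRrM.
  have -> : -1 * ((1 - g) * -1) = 1 - g by ring.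
  (* A positive level, so that its power of exponent [1 / (1 - g)] can be inverted. *)
  pose M : R := Num.max A 1.
  have M0 : 0 < M by rewrite lt_max ltr01 orbT.
  have eM : (M `^ (1 - g)^-1) `^ (1 - g) = M.
    by rewrite -powRrM mulVf ?powRr1 ?(ltW M0)// gt_eqF// subr_gt0.
  apply: (@le_trans _ _ M); first by rewrite le_max lexx.
  rewrite -eM (@ge0_ler_powR _ (1 - g)) ?nnegrE ?powR_ge0 ?subr_ge0 ?(ltW g1) ?(ltW n0)//.
  by near: n; move/cvgryPge : n8; exact.
rewrite recdistE//; apply: cvg_EFin; first by near=> n.
apply: (@continuous_cvg _ _ _ _ _ _ (fun y : R => y `^ (g - 1))).
  apply: differentiable_continuous; apply/derivable1_diffP.
  exact/ex_derive/is_derive1_powR.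
rewrite -[X in _ --> X]addr0; apply: cvgD => //; exact: cvg_cst.
Unshelve. all: by end_near. Qed.

Lemma measurable_recdist : measurable_fun setT recdist.
Proof.
apply: (emeasurable_fun_cvg
  (fun n p => ((cabs (zeta0 - toC p) + (n%:R + 8)^-1) `^ (g - 1))%:E)) => [n|p _].
  apply/measurable_EFinP; apply: (measurableT_comp (@measurable_powR R _)).
  by apply: measurable_funD => //; exact: measurable_cabs_dist.
exact: cvg_recdist.
Qed.

End reciprocal_distance.
End circle_measurability.

(** * Bounds for fractional integrals of Herglotz transforms *)

Section herglotz_bounds.
Context {R : realType}.
Variables (zeta0 : R[i]) (psi : {measure set (R * R) -> \bar R}) (g : R).
Hypotheses (zeta0_unit : cabs zeta0 = 1) (psi_fin : fin_num_fun psi).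
Hypotheses (g0 : 0 <= g) (g1 : g < 1).
Notation dist p := (cabs (zeta0 - toC p)).

Lemma recdist_eqy p : dist p = 0 -> recdist zeta0 g p = +oo%E.
Proof.
by move=> d0; rewrite /recdist d0 powR0 ?inve0// subr_eq0 gt_eqF.
Qed.

(** * Upper bound, for [P] the real or the imaginary part *)

Section upper_bound.
Variable P : R[i] -> R.
Hypothesis P_le : forall w, `|P w| <= cabs w.
Variables (sigma : R) (z : R[i]) (chi : {measure set (R * R) -> \bar R}).
Hypotheses (sigma1 : 1 < sigma) (z_stolz : stolz sigma zeta0 z) (z_neq0 : 0 < cabs z).
Hypotheses (chi_circle : circle_measure chi) (chi_psi : mprec chi psi).

(** The kernel is at most [2 / |p - w|], which [stolz_ray_dist] controls. The absolute value on
    [1 - x] keeps the majorant nonnegative for every real [x], as Tonelli's theorem on the whole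
    product will require. *)
Lemma Rintegral_cayley_le (x : R) : 0 <= x -> x <= cabs z ->
  (`|Rintegral chi unit_circle (fun p => P (cayley p (((x / cabs z)%:C)%C * z)))|%:E <=
   \int[psi]_(p in unit_circle) (2 * (2 + sigma) / (`|1 - x| + dist p))%:E)%E.
Proof.
move=> x0 xz; have x1 : x < 1 by case: z_stolz => + _; exact: le_lt_trans.
have mk : measurable_fun setT
    (fun p => (2 * (2 + sigma) / (`|1 - x| + dist p))%:E : \bar R).
  apply/measurable_EFinP; apply: measurable_funM => //; apply: measurable_funV.
  by apply: measurable_funD => //; exact: measurable_cabs_dist.
apply: (@le_trans _ _
  (\int[chi]_(p in unit_circle) (2 * (2 + sigma) / (`|1 - x| + dist p))%:E)%E).
  apply: normr_Rintegral_le => p p1; rewrite lee_fin.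
  apply: le_trans (P_le _) _; apply: le_trans (cabs_cayley_le p1 _) _.
    by rewrite cabs_ray.
  have h := stolz_ray_dist zeta0_unit sigma1 z_stolz z_neq0 x0 xz p1.
  have h1 := one_sub_le_cabs (((x / cabs z)%:C)%C * z) p1.
  rewrite cabs_ray// in h1.
  rewrite ger0_norm ?subr_ge0 ?(ltW x1)//.
  have d0 := cabs_ge0 (zeta0 - toC p).
  rewrite ler_pdivrMr; last by lra.
  rewrite mulrAC ler_pdivlMr; last by lra.
  by move: h h1; move: (cabs (toC p - _)) => A h h1; nra.
apply: ge0_integral_le_measure => //; first exact: measurable_unit_circle.
have M0 : 0 <= 2 * (2 + sigma) by move: sigma1 => s1; lra.
by move=> p; rewrite lee_fin divr_ge0 ?addr_ge0 ?cabs_ge0.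
Qed.

Definition upper_constant : R :=
  if g == 0 then 2 * (2 + sigma)
  else (Gamma g)^-1 * (2 * (2 + sigma) * (g^-1 + (1 - g)^-1)).

Lemma fracintR_cayley_le :
  (`|fracintR g (fun w => Rintegral chi unit_circle (fun p => P (cayley p w))) z|%:E <=
   upper_constant%:E * \int[psi]_(p in unit_circle) recdist zeta0 g p)%E.
Proof.
have z1 : cabs z < 1 by case: z_stolz.
have mC := @measurable_unit_circle R.
have mrec := @measurable_recdist R zeta0 g g1.
have M0 : 0 <= 2 * (2 + sigma) by move: sigma1 => s1; lra.
rewrite /fracintR /upper_constant; have [ge0|gn0] := eqVneq g 0.
  (* For [g = 0] there is no radial integral: the bound at [x = |z|] is already a multiple of
     [1 / d]. *)
  have := Rintegral_cayley_le (ltW z_neq0) (lexx _).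
  rewrite divff ?gt_eqF//= mul1r => h; apply: le_trans h _.
  rewrite -ge0_integralZl_EFin//; last 2 first.
  - by move=> p _; exact: recdist_ge0.
  - exact: measurable_funTS.
  apply: ge0_le_integral_any => p p1.
    by rewrite lee_fin divr_ge0// addr_ge0 ?cabs_ge0.
  (* At [zeta0] itself the right side is [+oo]. *)
  have := cabs_ge0 (zeta0 - toC p); rewrite le_eqVlt => /predU1P[d0|d0].
    by rewrite recdist_eqy// gt0_muley ?leey// lte_fin; move: sigma1 => s1; lra.
  rewrite recdistE// -EFinM lee_fin ge0 sub0r powR_inv1 ?cabs_ge0//.
  by rewrite ler_wpM2l// lef_pV2 ?posrE ?ltr_wpDl// lerDr.
have gp : 0 < g by rewrite lt_def gn0.
have C0 : 0 <= g^-1 + (1 - g)^-1 by rewrite addr_ge0// invr_ge0 ?subr_ge0 ltW.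
have Gi0 : 0 <= (Gamma g)^-1 by rewrite invr_ge0 ltW// Gamma_gt0.
rewrite normrM (ger0_norm Gi0) EFinM [in leRHS]EFinM -muleA.
rewrite lee_wpmul2l ?lee_fin//.
pose k (y : R * (R * R)) : \bar R :=
  ((cabs z - y.1) `^ (g - 1) * (2 * (2 + sigma) / (`|1 - y.1| + dist y.2)))%:E.
have mk : measurable_fun setT k.
  apply/measurable_EFinP; apply: measurable_funM.
    apply: (measurableT_comp (@measurable_powR R _)).
    by apply: measurable_funB.
  apply: measurable_funM => //; apply: measurable_funV; apply: measurable_funD => //.
    by apply: measurableT_comp => //; exact: measurable_funB.
  exact: (measurableT_comp (measurable_cabs_dist _)).
have k0 y : (0 <= k y)%E.
  by rewrite lee_fin mulr_ge0 ?powR_ge0// divr_ge0// addr_ge0 ?cabs_ge0.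
apply: (@le_trans _ _ (\int[lebesgue_measure]_(x in `[0%R, cabs z])
    \int[psi]_(p in unit_circle) k (x, p))%E).
  apply: normr_Rintegral_le => x/=; rewrite in_itv/= => /andP[x0 xz].
  rewrite normrM (ger0_norm (powR_ge0 _ _)) EFinM.
  apply: le_trans (lee_wpmul2l _ (Rintegral_cayley_le x0 xz)) _.
    by rewrite lee_fin powR_ge0.
  rewrite -ge0_integralZl_EFin ?powR_ge0//.
  - by move=> p _; rewrite lee_fin divr_ge0// addr_ge0 ?cabs_ge0.
  - apply/measurable_EFinP; apply: measurable_funTS; apply: measurable_funM => //.
    apply: measurable_funV; apply: measurable_funD => //; exact: measurable_cabs_dist.
rewrite (@fubini_tonelli_in _ _ _ _ _ lebesgue_measure _ psi_fin)//.
rewrite -ge0_integralZl_EFin//; last 3 first.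
- by move=> p _; exact: recdist_ge0.
- exact: measurable_funTS.
- by rewrite mulr_ge0.
apply: ge0_le_integral_any => p p1; first by apply: integral_ge0.
have := cabs_ge0 (zeta0 - toC p); rewrite le_eqVlt => /predU1P[d0|d0].
  rewrite recdist_eqy// gt0_muley ?leey// lte_fin mulr_gt0//; first by move: sigma1 => s1; lra.
  by rewrite addr_gt0// invr_gt0 ?subr_gt0.
rewrite recdistE//.
(* Replacing [1 - x] by the smaller [|z| - x] enlarges the integrand and matches the kernel estimate
   with [r = |z|]. *)
apply: (@le_trans _ _ (\int[lebesgue_measure]_(x in `[0%R, cabs z])
    ((2 * (2 + sigma))%:E * ((cabs z - x) `^ (g - 1) / (cabs z - x + dist p))%:E))%E).
  apply: ge0_le_integral_any => x/=; rewrite in_itv/= => /andP[x0 xz]; first exact: k0.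
  rewrite /k/= -EFinM lee_fin mulrCA ler_wpM2l// ler_wpM2l ?powR_ge0//.
  rewrite lef_pV2 ?posrE ?lerD2r; [|by rewrite ltr_wpDl|by rewrite ltr_wpDl ?subr_ge0].
  by apply: le_trans (ler_norm _); rewrite lerB// ltW.
rewrite ge0_integralZl_EFin//; last 2 first.
- move=> x/=; rewrite in_itv/= => /andP[x0 xz].
  by rewrite lee_fin divr_ge0 ?powR_ge0// addr_ge0 ?cabs_ge0 ?subr_ge0.
- apply/measurable_EFinP; apply: measurable_funM; first exact: measurable_powR_sub.
  apply: measurable_funTS; apply: measurable_funV; apply: measurable_funD => //.
  exact: measurable_funB.
rewrite [in leRHS]EFinM -muleA lee_wpmul2l ?lee_fin//.
by rewrite -EFinM; exact: integral_powR_sub_kernel_le.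
Qed.

End upper_bound.

(** * Lower bound from the restriction of [psi] to one side arc *)

Section lower_bound.
Variables (eps tau : R).
Hypotheses (eps_sqr : eps ^+ 2 = 1) (tau_gt0 : 0 < tau) (tau_le : tau <= 8^-1).
Notation arc := (side_arc zeta0 eps).
Notation dir := (tilted zeta0 eps tau).
Let mArc : measurable arc := measurable_side_arc zeta0 eps.
Let chi : {measure set (R * R) -> \bar R} := mrestr psi mArc.

Lemma side_arc_sub : arc `<=` unit_circle.
Proof. by move=> p []. Qed.

Lemma circle_measure_mrestr : circle_measure chi.
Proof.
rewrite /circle_measure -[LHS]/(psi (_ `&` arc)) (_ : _ `&` _ = set0) ?measure0//.
by apply/seteqP; split=> p //= [+ /side_arc_sub].
Qed.

Lemma mprec_mrestr : mprec chi psi.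
Proof.
move=> M mM _; apply: le_measure; rewrite ?inE//; exact: measurableI.
Qed.

Lemma Rintegral_mrestr (f : R * R -> R) : measurable_fun setT f ->
  Rintegral chi unit_circle f = Rintegral psi arc f.
Proof.
move=> mf; have mC := @measurable_unit_circle R.
have mCA : measurable (unit_circle `\` arc) by exact: measurableD.
rewrite /Rintegral; congr fine.
have -> : (unit_circle : set (R * R)) = arc `|` (unit_circle `\` arc).
  by rewrite setDE setUIr setUCr setIT setUidr//; exact: side_arc_sub.
rewrite integral_setU//; last 2 first.
- by apply/measurable_EFinP; exact: measurable_funTS.
- by apply/disj_setPS => p [/= ? []].
rewrite [X in (_ + X)%E]null_set_integral//; last 2 first.
- by apply/measurable_EFinP; exact: measurable_funTS.
- rewrite -[LHS]/(psi (_ `&` arc)) (_ : _ `&` _ = set0) ?measure0//.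
  by apply/seteqP; split=> p //= [[_ +] +].
rewrite adde0; apply: eq_measure_integral => A mA Aarc.
by rewrite -[LHS]/(psi (_ `&` arc)) setIidl.
Qed.

Lemma normr_eps : `|eps| = 1.
Proof.
by apply/eqP; rewrite -(@eqrXn2 _ 2)// expr1n real_normK ?num_real// eps_sqr.
Qed.

(** As [eps] is 1 or -1, only the negation rule is involved, which asks for no integrability. *)
Lemma Rintegral_sign (d : measure_display) (T : measurableType d)
    (mu : {measure set T -> \bar R}) (D : set T) (f : T -> R) :
  Rintegral mu D (fun x => eps * f x) = eps * Rintegral mu D f.
Proof.
have /orP[/eqP ->|/eqP ->] : (eps == 1) || (eps == -1) by rewrite -sqrf_eq1 eps_sqr.
  by rewrite mul1r; congr (fine _); apply: eq_integral => x _; rewrite mul1r.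
rewrite mulN1r -RintegralN_any.
by congr (fine _); apply: eq_integral => x _; rewrite mulN1r.
Qed.

Let u (x : R) := eps * complex.Im (herglotz chi ((x%:C)%C * dir)).

Lemma side_herglotzE (x : R) :
  u x = Rintegral psi arc (fun p => eps * complex.Im (cayley p ((x%:C)%C * dir))).
Proof.
rewrite Rintegral_sign -Rintegral_mrestr//; exact: measurable_Im_cayley.
Qed.

(** Crude, from [|p - w| >= 1 - x >= tau]; it serves to make the integrals finite, so that [fine]
    keeps their values. *)
Lemma side_cayley_le (p : R * R) (x : R) : arc p -> 0 <= x -> x <= 1 - tau ->
  eps * complex.Im (cayley p ((x%:C)%C * dir)) <= 2 / tau.
Proof.
move=> [p1 _] x0 xt; apply: le_trans (ler_norm _) _; rewrite normrM normr_eps mul1r.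
apply: le_trans (normr_Im_le_cabs _) _.
have wx : cabs ((x%:C)%C * dir) = x by rewrite cabsM cabs_tilted// mulr1 cabs_real.
have h := one_sub_le_cabs ((x%:C)%C * dir) p1.
have t0 := tau_gt0; rewrite wx in h.
apply: le_trans (cabs_cayley_le p1 _) _; first by rewrite wx; lra.
by rewrite ler_wpM2l// lef_pV2 ?posrE//; lra.
Qed.

Let bound : R := 2 / tau * fine (psi arc).

Lemma side_integral_le (x : R) : 0 <= x -> x <= 1 - tau ->
  (\int[psi]_(p in arc) (eps * complex.Im (cayley p ((x%:C)%C * dir)))%:E <= bound%:E)%E.
Proof.
move=> x0 xt; apply: (@le_trans _ _ (\int[psi]_(p in arc) (cst (2 / tau)%:E p))%E).
  apply: ge0_le_integral_any => p ap; rewrite lee_fin.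
    exact: Im_cayley_side_ge0 (ltW tau_gt0) _ _ _.
  exact: side_cayley_le.
by rewrite integral_cst// /bound [leRHS]EFinM fineK// psi_fin.
Qed.

Lemma side_herglotz_ge (x : R) (f : R * R -> \bar R) : 0 <= x -> x <= 1 - tau ->
  (forall p, arc p -> (0 <= f p)%E) ->
  (forall p, arc p -> (f p <= (eps * complex.Im (cayley p ((x%:C)%C * dir)))%:E)%E) ->
  (\int[psi]_(p in arc) f p <= (u x)%:E)%E.
Proof.
move=> x0 xt f0 fle; rewrite side_herglotzE.
exact: integral_le_Rintegral (side_integral_le x0 xt).
Qed.

Lemma side_herglotz_ge0 (x : R) : 0 <= x -> x <= 1 - tau -> 0 <= u x.
Proof.
move=> x0 xt; rewrite side_herglotzE; apply: Rintegral_ge0 => p ap.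
exact: Im_cayley_side_ge0 (ltW tau_gt0) _ _ _.
Qed.

Lemma side_herglotz_le (x : R) : 0 <= x -> x <= 1 - tau -> u x <= bound.
Proof.
move=> x0 xt; rewrite -lee_fin; apply: le_trans (side_integral_le x0 xt).
rewrite side_herglotzE; set f := fun p => _.
have h : (`|Rintegral psi arc f|%:E <= \int[psi]_(p in arc) (f p)%:E)%E.
  apply: normr_Rintegral_le => p ap; rewrite ger0_norm//.
  exact: Im_cayley_side_ge0 (ltW tau_gt0) _ _ _.
by apply: le_trans h; rewrite lee_fin ler_norm.
Qed.

Let z := (((1 - tau)%:C)%C * dir).

Lemma cabs_scaled_tilted : cabs z = 1 - tau.
Proof.
have t8 := tau_le; rewrite cabsM cabs_tilted// mulr1 cabs_real//; lra.
Qed.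

Lemma ray_scaled_tilted (x : R) : ((x / cabs z)%:C)%C * z = (x%:C)%C * dir.
Proof.
have t8 := tau_le.
have t1 : 1 - tau != 0 by rewrite gt_eqF//; lra.
by rewrite cabs_scaled_tilted /z mulrA -rmorphM/= divfK.
Qed.

(** [128 = 32 * 4]: 32 comes from the kernel bound, 4 from the radial length [D / 4]. *)
Definition lower_constant : R := if g == 0 then 32 else 128 * Gamma g.

Lemma side_arc_integral_le :
  (\int[psi]_(p in arc) ((dist p + tau) `^ (g - 1))%:E <=
   (lower_constant * `|fracintR g (fun w => complex.Im (herglotz chi w)) z|)%:E)%E.
Proof.
have t0 := tau_gt0; have t8 := tau_le.
have r0 : 0 < 1 - tau by lra.
have D0 p : 0 < dist p + tau by rewrite ltr_wpDl// cabs_ge0.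
have mD : measurable_fun setT (fun p : R * R => dist p + tau).
  by apply: measurable_funD => //; exact: measurable_cabs_dist.
have mDg (e : R) : measurable_fun setT (fun p : R * R => (dist p + tau) `^ e).
  exact: (measurableT_comp (@measurable_powR R _)).
rewrite /fracintR /lower_constant; have [ge0|gn0] := eqVneq g 0.
  (* For [g = 0] the kernel bound at the endpoint [x = 1 - tau] suffices. *)
  apply: (@le_trans _ _ (32%:E * (u (1 - tau))%:E)%E); last first.
    rewrite -EFinM lee_fin ler_wpM2l// /u -/z.
    by apply: le_trans (ler_norm _) _; rewrite normrM normr_eps mul1r.
  rewrite (_ : integral _ _ _ =
    (32%:E * \int[psi]_(p in arc) ((32 * (dist p + tau))^-1)%:E)%E); last first.
    rewrite -ge0_integralZl_EFin//; last 2 first.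
    - by move=> p _; rewrite lee_fin invr_ge0 mulr_ge0// ltW.
    - apply/measurable_EFinP; apply: measurable_funTS; apply: measurable_funV.
      exact: measurable_funM.
    apply: eq_integral => p _; rewrite -EFinM; congr EFin.
    rewrite ge0 sub0r powR_inv1 ?(ltW (D0 _))// invfM mulrA divff ?mul1r//.
  rewrite lee_wpmul2l//; apply: side_herglotz_ge; [exact: ltW|by []| |] => p ap.
    by rewrite lee_fin invr_ge0 mulr_ge0// ltW.
  rewrite lee_fin; apply: Im_cayley_side_ge => //.
  by rewrite gerBl divr_ge0// ltW.
have gp : 0 < g by rewrite lt_def gn0.
have Gg : 0 < Gamma g by exact: Gamma_gt0.
(* The window [1 - tau - D/4 <= x < 1 - tau]. The right end is excluded because there
   [(1 - tau - x)] vanishes and [powR] returns 0 instead of a large value. *)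
pose S : set (R * (R * R)) :=
  (setT `&` (fun y => y.1 + (dist y.2 + tau) / 4) @^-1` `[1 - tau, +oo[%classic) `&`
  (setT `&` fst @^-1` `]-oo, 1 - tau[%classic).
have mS : measurable S.
  apply: measurableI; last exact: measurable_fst.
  suff : measurable_fun setT (fun y : R * (R * R) => y.1 + (dist y.2 + tau) / 4) by exact.
  apply: measurable_funD => //; apply: measurable_funM => //.
  exact: (measurableT_comp mD).
have SE (x : R) (p : R * R) : \1_S (x, p) =
    \1_(`[1 - tau - (dist p + tau) / 4, 1 - tau[%classic) x :> R.
  rewrite !indicE; congr ((nat_of_bool _)%:R); apply/idP/idP.
    rewrite !inE /S/= !in_itv/= andbT => -[[_ h1] [_ h2]]; rewrite h2 andbT.
    by rewrite lerBlDr.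
  rewrite !inE /S/= !in_itv/= andbT => /andP[h1 h2].
  by rewrite h2; split; split => //; rewrite -lerBlDr.
pose k (y : R * (R * R)) : \bar R :=
  ((dist y.2 + tau) `^ (g - 1) * (32 * (dist y.2 + tau))^-1 * \1_S y)%:E.
have mk : measurable_fun setT k.
  apply/measurable_EFinP; apply: measurable_funM; last exact: measurable_indic.
  apply: measurable_funM; first exact: (measurableT_comp (mDg _)).
  apply: measurable_funV; apply: measurable_funM => //.
  exact: (measurableT_comp mD).
have k0 y : (0 <= k y)%E.
  by rewrite lee_fin mulr_ge0// mulr_ge0 ?powR_ge0// invr_ge0 mulr_ge0// ltW.
have inner p : arc p ->
    ((dist p + tau) `^ (g - 1) / 128)%:E =
    (\int[lebesgue_measure]_(x in `[0%R, (1 - tau)%R]) k (x, p))%E.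
  move=> ap; have [d1 _] := side_arc_dist zeta0_unit eps_sqr ap.
  have DD := D0 p.
  under eq_integral do rewrite /k/= SE EFinM.
  rewrite ge0_integralZl_EFin//; last 2 first.
  - by apply/measurable_EFinP; exact: measurable_indic.
  - by rewrite mulr_ge0 ?powR_ge0// invr_ge0 mulr_ge0// ltW.
  (* As [d <= 1] and [tau <= 1/8], the window lies in [[0, 1 - tau]], so its whole length [D / 4]
     counts. *)
  rewrite integral_indic//= setIidl; last first.
    move=> x/=; rewrite !in_itv/= => /andP[h1 h2]; rewrite (ltW h2) andbT.
    by apply: le_trans h1; lra.
  rewrite lebesgue_measure_itv/= lte_fin gtrBl divr_gt0//.
  rewrite -EFinB -EFinM; congr EFin; field; lra.
pose v x := (1 - tau - x) `^ (g - 1) * u x.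
(* On the window [0 < 1 - tau - x <= D], so the weight is at least [D^(g-1)] and the kernel at least
   [1 / (32 D)]; off it [k] is 0 and the kernel is nonnegative. *)
have k_le x : 0 <= x -> x <= 1 - tau -> (\int[psi]_(p in arc) k (x, p) <= (v x)%:E)%E.
  move=> x0 xt; rewrite /v.
  pose f (p : R * R) : \bar R := ((32 * (dist p + tau))^-1 * \1_S (x, p))%:E.
  have f0 p : (0 <= f p)%E by rewrite lee_fin mulr_ge0// invr_ge0 mulr_ge0// ltW.
  apply: (@le_trans _ _ (((1 - tau - x) `^ (g - 1))%:E * \int[psi]_(p in arc) f p)%E).
    rewrite -ge0_integralZl_EFin ?powR_ge0//; last first.
      apply/measurable_EFinP; apply: measurable_funTS; apply: measurable_funM.
        by apply: measurable_funV; exact: measurable_funM.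
      apply: (@measurableT_comp _ _ _ _ _ _ (\1_S : R * (R * R) -> R) _ (pair x)).
        exact: measurable_indic.
      exact: pair1_measurable.
    apply: ge0_le_integral_any => p ap //.
    rewrite /f /k/= -EFinM lee_fin SE indicE.
    case: (boolP (x \in _)) => [|_]; last by rewrite !mulr0.
    rewrite inE/= in_itv/= !mulr1 => /andP[h1 h2].
    rewrite ler_wpM2r ?invr_ge0 ?mulr_ge0 ?(ltW (D0 _))//.
    have DD := D0 p.
    apply: powR_antimono; [by rewrite subr_le0 ltW|by rewrite subr_gt0|lra].
  rewrite EFinM lee_wpmul2l ?lee_fin ?powR_ge0//.
  apply: side_herglotz_ge => // p ap; rewrite lee_fin SE indicE.
  case: (boolP (x \in _)) => [|_]; last first.
    by rewrite mulr0; exact: Im_cayley_side_ge0 (ltW t0) _ _ _.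
  rewrite inE/= in_itv/= mulr1 => /andP[h1 h2].
  exact: Im_cayley_side_ge.
(* Finiteness of the radial integral, again for the sake of [fine]. *)
have v_le : (\int[lebesgue_measure]_(x in `[0%R, (1 - tau)%R]) (v x)%:E <=
    (bound * ((1 - tau) `^ g / g))%:E)%E.
  have b0 : 0 <= bound by rewrite mulr_ge0 ?divr_ge0 ?fine_ge0// ltW.
  apply: (@le_trans _ _ (\int[lebesgue_measure]_(x in `[0%R, (1 - tau)%R])
      (bound%:E * ((1 - tau - x) `^ (g - 1))%:E))%E).
    apply: ge0_le_integral_any => x/=; rewrite in_itv/= => /andP[x0 xt].
      by rewrite lee_fin mulr_ge0 ?powR_ge0//; exact: side_herglotz_ge0.
    rewrite -EFinM lee_fin /v [leRHS]mulrC ler_wpM2l ?powR_ge0//.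
    exact: side_herglotz_le.
  rewrite ge0_integralZl_EFin//; last 2 first.
  - by move=> x _; rewrite lee_fin powR_ge0.
  - by apply/measurable_EFinP; exact: measurable_powR_sub.
  rewrite [leRHS]EFinM lee_wpmul2l ?lee_fin//.
  by have := integral_powR_sub_sing gp r0; rewrite subr0.
have main : (\int[psi]_(p in arc) ((dist p + tau) `^ (g - 1) / 128)%:E <=
    (Rintegral lebesgue_measure `[0, (1 - tau)%R]%classic v)%:E)%E.
  have <- : (\int[psi]_(p in arc)
      \int[lebesgue_measure]_(x in `[0%R, (1 - tau)%R]) k (x, p) =
      \int[psi]_(p in arc) ((dist p + tau) `^ (g - 1) / 128)%:E)%E.
    by apply: eq_integral => p; rewrite inE => ap; rewrite -inner.
  rewrite -(@fubini_tonelli_in _ _ _ _ _ lebesgue_measure _ psi_fin)//.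
  apply: integral_le_Rintegral v_le => x/=; rewrite in_itv/= => /andP[x0 xt].
    exact: integral_ge0.
  exact: k_le.
rewrite (_ : integral _ _ _ =
  (128%:E * \int[psi]_(p in arc) ((dist p + tau) `^ (g - 1) / 128)%:E)%E); last first.
  rewrite -ge0_integralZl_EFin//; last 2 first.
  - by move=> p _; rewrite lee_fin divr_ge0 ?powR_ge0.
  - apply/measurable_EFinP; apply: measurable_funTS.
    by apply: measurable_funM.
  by apply: eq_integral => p _; rewrite -EFinM mulrC divfK.
apply: le_trans (lee_wpmul2l _ main) _ => //.
rewrite -EFinM lee_fin -mulrA ler_wpM2l//.
rewrite normrM (ger0_norm (_ : 0 <= (Gamma g)^-1)) ?invr_ge0 ?(ltW Gg)//.
rewrite mulrA divff ?gt_eqF// mul1r cabs_scaled_tilted.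
(* The sign [eps] leaves the radial integral and disappears in the modulus. *)
set L := leLHS; have -> : L = eps * Rintegral lebesgue_measure `[0, (1 - tau)%R]%classic
    (fun x => (1 - tau - x) `^ (g - 1) * complex.Im (herglotz chi ((x%:C)%C * dir))).
  rewrite /L -Rintegral_sign; apply: eq_Rintegral => x _.
  by rewrite /v /u mulrCA.
apply: le_trans (ler_norm _) _; rewrite normrM normr_eps mul1r.
rewrite -cabs_scaled_tilted.
by under [X in _ <= `|X|]eq_Rintegral do rewrite ray_scaled_tilted.
Qed.

End lower_bound.

(** * Limit in [tau] and sum over the arcs *)

Lemma integral_recdist_le (A : set (R * R)) (B : R) : measurable A ->
  (forall n : nat, (\int[psi]_(p in A) ((dist p + (n%:R + 8)^-1) `^ (g - 1))%:E <= B%:E)%E) ->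
  (\int[psi]_(p in A) recdist zeta0 g p <= B%:E)%E.
Proof.
move=> mA hB.
pose f (n : nat) (p : R * R) : \bar R := ((dist p + (n%:R + 8)^-1) `^ (g - 1))%:E.
have mf n : measurable_fun A (f n).
  apply/measurable_EFinP; apply: measurable_funTS.
  apply: (measurableT_comp (@measurable_powR R _)).
  by apply: measurable_funD => //; exact: measurable_cabs_dist.
have f0 n p : A p -> (0 <= f n p)%E by rewrite lee_fin powR_ge0.
have n0 n : 0 < (n%:R + 8 : R)^-1 by rewrite invr_gt0 ltr_wpDl.
have ndf p : A p -> nondecreasing_seq (f ^~ p).
  move=> _ n m nm; rewrite lee_fin powR_antimono ?subr_le0 ?(ltW g1)//.
    by rewrite ltr_wpDl ?cabs_ge0.
  by rewrite lerD2l lef_pV2 ?posrE ?ltr_wpDl// lerD2r ler_nat.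
have -> : (\int[psi]_(p in A) recdist zeta0 g p =
    \int[psi]_(p in A) limn (f ^~ p))%E.
  apply: eq_integral => p _; apply/esym/cvg_lim => //.
  exact: cvg_recdist.
(* The shifts decrease and the exponent is negative, so the integrands increase with [n]. *)
rewrite monotone_convergence//; apply: lime_le; last exact: nearW.
apply: ereal_nondecreasing_is_cvgn => n m nm.
by apply: ge0_le_integral_any => p Ap; [exact: f0|exact: ndf].
Qed.

Lemma far_arc_recdist_le1 p : unit_circle p ->
  complex.Re zeta0 * p.1 + complex.Im zeta0 * p.2 < 2^-1 ->
  (recdist zeta0 g p <= 1)%E.
Proof.
move=> p1 c2; have d2 := cabs_dist_sqr zeta0_unit p1.
have d1 : 1 <= dist p.
  by rewrite -(@ler_pXn2r _ 2) ?nnegrE ?cabs_ge0// expr1n d2; lra.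
rewrite recdistE ?(lt_le_trans ltr01)// lee_fin -[leRHS](powRr0 (dist p)) ler_powR//.
by rewrite subr_le0 ltW.
Qed.

(** The two side arcs cover the part of the circle with cosine at least [1/2]; on the rest [d >= 1],
    the integrand is at most 1 and [psi] is finite. *)
Lemma integral_recdist_lty (K : R) :
  (forall chi : {measure set (R * R) -> \bar R}, circle_measure chi -> mprec chi psi ->
    forall z, stolz_star 4 zeta0 z ->
    `|fracintR g (fun w => complex.Im (herglotz chi w)) z| <= K) ->
  (\int[psi]_(p in unit_circle) recdist zeta0 g p < +oo)%E.
Proof.
move=> hK; have mC := @measurable_unit_circle R.
have mrec := @measurable_recdist R zeta0 g g1.
have lc0 : 0 <= lower_constant.
  rewrite /lower_constant; case: eqVneq => // gn0.
  by rewrite mulr_ge0// ltW// Gamma_gt0// lt_def gn0.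
(* The restricted measure depends on the side alone, while the tilt [1 / (n + 8)] shrinks. *)
have side eps : eps ^+ 2 = 1 ->
    (\int[psi]_(p in side_arc zeta0 eps) recdist zeta0 g p <= (lower_constant * K)%:E)%E.
  move=> e1; apply: integral_recdist_le => [|n]; first exact: measurable_side_arc.
  have t0 : 0 < (n%:R + 8 : R)^-1 by rewrite invr_gt0 ltr_wpDl.
  have t8 : (n%:R + 8 : R)^-1 <= 8^-1 by rewrite lef_pV2 ?posrE ?ltr_wpDl// lerDr.
  apply: le_trans (side_arc_integral_le e1 t0 t8) _.
  rewrite lee_fin ler_wpM2l//; apply: hK; last exact: tilted_stolz.
  - exact: circle_measure_mrestr.
  - exact: mprec_mrestr.
pose near_arc := side_arc zeta0 1 `|` side_arc zeta0 (-1).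
have mN : measurable near_arc by apply: measurableU; exact: measurable_side_arc.
have mF : measurable (unit_circle `\` near_arc) by exact: measurableD.
have -> : (unit_circle : set (R * R)) = near_arc `|` (unit_circle `\` near_arc).
  by rewrite setDE setUIr setUCr setIT setUidr// => p [] [].
apply: le_lt_trans (ge0_integral_setU_le _ mN mF mrec (@recdist_ge0 _ _ _)) _.
apply: lte_add_pinfty.
  apply: le_lt_trans (ge0_integral_setU_le _ (measurable_side_arc _ _)
    (measurable_side_arc _ _) mrec (@recdist_ge0 _ _ _)) _.
  apply: lte_add_pinfty; apply: le_lt_trans (ltry _); apply: side.
    by rewrite expr1n.
  by rewrite sqrrN expr1n.
apply: (@le_lt_trans _ _ (\int[psi]_(p in unit_circle `\` near_arc) (cst 1%E p))%E).
  apply: ge0_le_integral_any => p; first by move=> _; exact: recdist_ge0.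
  move=> [p1 np]; apply: far_arc_recdist_le1 => //; rewrite ltNge; apply/negP => c2.
  apply: np; have [s0|/ltW s0] := leP (complex.Re zeta0 * p.2 - complex.Im zeta0 * p.1) 0.
    by left; split => //; split => //; rewrite mul1r.
  by right; split => //; split => //; rewrite mulN1r oppr_le0.
by rewrite integral_cst// mul1e ltey_eq psi_fin.
Qed.

End herglotz_bounds.

(** The line splits into two null tails and [[-pi, pi]], of mass [psis pi - psis (- pi)]. *)
Lemma generated_by_fin_num (R : realType) (psis : R -> R)
    (psi : {measure set (R * R) -> \bar R}) :
  generated_by psis psi -> fin_num_fun psi.
Proof.
move=> [mu [[mul mur mum _] psiE]]; apply: lty_fin_num_fun.
rewrite psiE// preimage_setT.
have -> : [set: R] = `]-oo, (- pi)%R[%classic `|` `[(- pi)%R, pi]%classic `|`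
    `]pi, +oo[%classic.
  apply/seteqP; split=> // x _ /=; rewrite !in_itv/= andbT.
  have [h1|h1] := ltP x (- pi); first by left; left.
  by have [h2|h2] := leP x pi; [left; right|right].
apply: le_lt_trans (measureU2 _ _ _) _ => //; first exact: measurableU.
apply: lte_add_pinfty; last exact: (eq_ind_r (fun x => x < +oo)%E (ltry 0) mur).
apply: le_lt_trans (measureU2 _ _ _) _ => //.
apply: lte_add_pinfty; first exact: (eq_ind_r (fun x => x < +oo)%E (ltry 0) mul).
exact: (eq_ind_r (fun x => x < +oo)%E (ltry _) mum).
Qed.

Theorem theorem3 (R : realType) (psis : R -> R)
    (psi : {measure set (R * R) -> \bar R}) (g : R) (zeta0 : R[i]) :
  nondecreasing_on_mpipi psis ->
  generated_by psis psi ->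
  0 <= g -> g < 1 ->
  cabs zeta0 = 1 ->
  let C1 := forall sigma : R, 1 < sigma ->
      exists K : R, 0 < K /\
        forall chi : {measure set (R * R) -> \bar R},
          circle_measure chi -> mprec chi psi ->
          (ereal_sup [set (cabs (fracintC g (herglotz chi) z))%:E
                     | z in stolz_star sigma zeta0] < K%:E)%E in
  let C2 := forall sigma : R, 1 < sigma ->
      exists K : R, 0 < K /\
        forall chi : {measure set (R * R) -> \bar R},
          circle_measure chi -> mprec chi psi ->
          (ereal_sup [set (`| fracintR g (fun w => complex.Im (herglotz chi w)) z |)%:E
                     | z in stolz_star sigma zeta0] < K%:E)%E in
  let C3 := (\int[psi]_(p in unit_circle)
                inve ((cabs (zeta0 - toC p) `^ (1 - g))%:E) < +oo)%E in
  (C1 <-> C2) /\ (C2 <-> C3).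
Proof.
move=> _ psi_gen g0 g1 zeta0_unit C1 C2 C3.
have psi_fin := generated_by_fin_num psi_gen.
have C12 : C1 -> C2.
  move=> c1 sigma s1; have [K [K0 hK]] := c1 sigma s1; exists K; split=> // chi cc cp.
  apply: le_lt_trans (hK chi cc cp); apply: ge_ereal_sup => _ [z zS <-].
  apply: le_trans (ereal_sup_ubound _); last by exists z.
  by rewrite lee_fin (normr_Im_le_cabs (fracintC g (herglotz chi) z)).
have C23 : C2 -> C3.
  (* Aperture 4 is the one that contains the tilted points. *)
  move=> c2; have [|K [K0 hK]] := c2 4; first by rewrite ltr1n.
  apply: (@integral_recdist_lty _ _ _ _ zeta0_unit psi_fin g0 g1 K) => chi cc cp z zS.
  rewrite -lee_fin ltW//; apply: le_lt_trans (hK chi cc cp).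
  by apply: ereal_sup_ubound; exists z.
have C31 : C3 -> C1.
  rewrite /C3 -/(recdist zeta0 g) => c3 sigma s1.
  pose I := (\int[psi]_(p in unit_circle) recdist zeta0 g p)%E.
  have I0 : (0 <= I)%E by apply: integral_ge0 => p _; exact: recdist_ge0.
  have If : I \is a fin_num by rewrite ge0_fin_numE.
  pose B := upper_constant g sigma * fine I.
  have B0 : 0 <= B.
    rewrite mulr_ge0 ?fine_ge0// /upper_constant; case: eqVneq => [_|gn0]; first lra.
    have gp : 0 < g by rewrite lt_def gn0.
    rewrite mulr_ge0 ?invr_ge0 ?(ltW (Gamma_gt0 _ _))// mulr_ge0//; first lra.
    by rewrite addr_ge0// invr_ge0 ?subr_ge0 ltW.
  (* One [B] for each of the real and imaginary parts, and 1 for strictness; [B] does not involve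
     [chi]. *)
  exists (B + B + 1); split=> [|chi cc cp]; first lra.
  apply: (@le_lt_trans _ _ (B + B)%:E); last by rewrite lte_fin ltrDl.
  apply: ge_ereal_sup => _ [z [zS z2] <-]; rewrite lee_fin.
  (* The ray through [z] divides by [|z|]; the truncation to distance less than [1/2] from [zeta0]
     excludes the origin. *)
  have z0 : 0 < cabs z.
    rewrite lt_neqAle cabs_ge0 andbT eq_sym; apply/eqP => /cabs_eq0 z0.
    by move: z2; rewrite /= z0 sub0r cabsN zeta0_unit; lra.
  have part P : (forall w, `|P w| <= cabs w) ->
      `|fracintR g (fun w => Rintegral chi unit_circle (fun p => P (cayley p w))) z| <= B.
    move=> hP; rewrite -lee_fin EFinM fineK//.
    exact: fracintR_cayley_le.
  apply: le_trans (cabs_le_ReIm _) _; apply: lerD.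
    exact (part (@complex.Re R) (@normr_Re_le_cabs R)).
  exact (part (@complex.Im R) (@normr_Im_le_cabs R)).
by split; split=> // h; [exact/C31/C23|exact/C12/C31].
Qed.
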